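(* Let $F$ be a number field of degree $n$, let $C\ge1$ and let $\delta=\log\left(1+\frac{\sqrt3}{2C^2}\right)$. (i) Let $D$ and $D'$ be two strongly $C$-reduced oriented Arakelov divisors of degree $0$. If there exists $f\in F^*_+$ such that $D-D'+(f)=(O_F,v)$ with $|\log v_\sigma|<\delta$ for each infinite place $\sigma$, then $D=D'$ in $\widetilde{\mathrm{Div}}^0_F$. In particular, if there exists $f\in F^*_+$ with $D-D'+(f)=(O_F,v)$ and $\|v\|_{\widetilde{Pic}}<\delta$, then $D=D'$ in $\widetilde{\mathrm{Div}}^0_F$. (ii) The natural map from $$\bigcup_{D\in Sred_F^C}\left\{D+(O_F,v):\ v\in(F^*_{\mathbb R,conn})^0\text{ and }|\log v_\sigma|<\tfrac12\delta\text{ for each }\sigma\right\}$$ to $\widetilde{\mathrm{Pic}}^0_F$ is injective.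
   Context: $F$ has $r_1$ real and $r_2$ complex infinite places $\sigma$ (one embedding per complex place), $\deg\sigma=1$ or $2$ accordingly. $F_{\mathbb R}=F\otimes\mathbb R\cong\prod_{\text{real}}\mathbb R\times\prod_{\text{complex}}\mathbb C$, $F$ embedded by $f\mapsto(\sigma(f))_\sigma$, with norm $\|x\|^2=\sum_{\text{real}}|x_\sigma|^2+2\sum_{\text{complex}}|x_\sigma|^2$ (so $\|1\|=\sqrt n$); $F_{\mathbb R}^*$ is its unit group, with norm $N(u)=\prod_{\text{real}}u_\sigma\prod_{\text{complex}}|u_\sigma|^2$. An oriented Arakelov divisor is a pair $(I,u)$, $I$ a fractional ideal, $u\in F^*_{\mathbb R}$; they form a group under $(I,u)+(J,w)=(IJ,uw)$, and the degree of $(I,u)$ is $-\log N(I)-\sum_\sigma\deg(\sigma)\log|u_\sigma|$. $\widetilde{\mathrm{Div}}^0_F$ is the group of degree-$0$ oriented divisors. The principal oriented divisor of $f\in F^*$ is $(f)=(f^{-1}O_F,(\sigma(f))_\sigma)$, and $\widetilde{\mathrm{Pic}}^0_F$ is $\widetilde{\mathrm{Div}}^0_F$ modulo principal oriented divisors. $F^*_+=\{f\in F^*:\sigma(f)>0\text{ for all real }\sigma\}$, $O^*_{F,+}=O_F^*\cap F^*_+$, $F^*_{\mathbb R,conn}\cong\prod_{\text{real}}\mathbb R_{>0}\times\prod_{\text{complex}}\mathbb C^*$ is the identity component of $F^*_{\mathbb R}$, and $(F^*_{\mathbb R,conn})^0=\{u\in F^*_{\mathbb R,conn}:N(u)=1\}$.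 For $u\in F^*_{\mathbb R}$, $\log u_\sigma$ uses the principal branch of the complex logarithm, and $\|u\|_{\widetilde{Pic}}^2=\min_{\varepsilon\in O^*_{F,+}}\sum_\sigma\deg(\sigma)|\log(u_\sigma\sigma(\varepsilon))|^2$. For a fractional ideal $I$, $d(I)$ is the oriented divisor $(I,u)$ with $u_\sigma=N(I)^{-1/n}$ for all $\sigma$. A fractional ideal $I$ is strongly $C$-reduced if $1\in I$, $1$ is primitive in $I$ (i.e. $1/d\notin I$ for every integer $d\ge2$), and $\|1\|\le C\|g\|$ for all nonzero $g\in I$; a divisor is strongly $C$-reduced if it equals $d(I)$ for a strongly $C$-reduced $I$, and $Sred_F^C$ denotes the set of strongly $C$-reduced divisors. *)

(* Defs.v *)
(* A number field is a [fieldExtType rat]; the real numbers are any [R : realType]. *)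
From HB Require Import structures.
From mathcomp Require Import all_boot all_order all_algebra all_field.
From mathcomp Require Import finmap complex.
From mathcomp Require Import all_classical all_reals all_analysis.

Set Implicit Arguments.
Unset Strict Implicit.
Unset Printing Implicit Defensive.

Import Order.TTheory GRing.Theory Num.Theory.

Local Open Scope classical_set_scope.
Local Open Scope complex_scope.
Local Open Scope ring_scope.

Section ComplexLog.
Variable R : realType.

(* The real-valued modulus; the library norm [`|z|] lives in [R[i]]. *)
Definition cabs (z : R[i]) : R := ComplexField.Normc.normc z.

(* Principal argument, in ]-pi, pi]. *)
Definition Arg (z : R[i]) : R :=
  let t := acos (complex.Re z / cabs z) in
  if complex.Im z < 0 then - t else t.

Definition Log (z : R[i]) : R[i] := Complex (ln (cabs z)) (Arg z).

End ComplexLog.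

Section FractionalIdeals.
Variable F : fieldExtType rat.

Definition OF : set F := [set x | integralOver (intr : int -> F) x].

Definition fractional_ideal (I : set F) : Prop :=
  [/\ forall x y, I x -> I y -> I (x + y),
      forall a x, OF a -> I x -> I (a * x),
      exists2 x, I x & x != 0
    & exists d, [/\ OF d, d != 0 & forall x, I x -> OF (d * x)]].

Definition ideal_mul (I J : set F) : set F :=
  [set x | exists s : seq (F * F),
     (forall p, p \in s -> I p.1 /\ J p.2) /\ x = \sum_(p <- s) p.1 * p.2].

Definition ideal_inv (I : set F) : set F :=
  [set x | forall y, I y -> OF (x * y)].

Definition cosets (A B : set F) : set (set F) :=
  [set [set x + y | y in B] | x in A].

(* For additive subgroups B of A; [fset_set] of an infinite set is empty. *)
Definition subgroup_index (A B : set F) : nat :=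
  #|` fset_set (cosets A B)|%fset.

(* Equal to [O_F : I] when I is contained in O_F; in general this is the
   generalised lattice index, the multiplicative extension of [O_F : I]. *)
Definition ideal_norm (R : realType) (I : set F) : R :=
  (subgroup_index OF (OF `&` I))%:R / (subgroup_index I (OF `&` I))%:R.

End FractionalIdeals.
Arguments OF : clear implicits.

(* [rplace] lists the real embeddings and [cplace] contains one embedding out of
   each pair of conjugate nonreal ones. *)
Record infinite_places (R : realType) (F : fieldExtType rat) := InfinitePlaces {
  r1 : nat;
  r2 : nat;
  rplace : 'I_r1 -> {rmorphism F -> R};
  cplace : 'I_r2 -> {rmorphism F -> R[i]};
  rplace_inj : forall i j, rplace i =1 rplace j -> i = j;
  cplace_nonreal : forall j, exists x, complex.Im (cplace j x) != 0;
  cplace_inj : forall i j,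
    cplace i =1 cplace j \/ cplace i =1 conjc \o cplace j -> i = j;
  places_exhaustive : forall phi : {rmorphism F -> R[i]},
    (exists i, phi =1 fun x => (rplace i x)%:C) \/
    (exists j, phi =1 cplace j \/ phi =1 conjc \o cplace j)
}.

Arguments r1 {R F}.
Arguments r2 {R F}.
Arguments rplace {R F}.
Arguments cplace {R F}.

Section Arakelov.
Variables (R : realType) (F : fieldExtType rat) (P : infinite_places R F).

Definition place : finType := ('I_(r1 P) + 'I_(r2 P))%type.

Definition pdeg (s : place) : nat := if s is inl _ then 1%N else 2%N.

Definition FR : pzRingType :=
  ({ffun 'I_(r1 P) -> R} * {ffun 'I_(r2 P) -> R[i]})%type.

Definition place_val (u : FR) (s : place) : R[i] :=
  match s with inl i => (u.1 i)%:C | inr j => u.2 j end.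

Definition FR_embed (f : F) : FR :=
  ([ffun i => rplace P i f], [ffun j => cplace P j f]).

Definition FR_const (a : R) : FR := ([ffun=> a], [ffun=> a%:C]).

Definition FR_norm (x : FR) : R :=
  Num.sqrt (\sum_i `|x.1 i| ^+ 2 + 2 * \sum_j cabs (x.2 j) ^+ 2).

Definition FR_unit : set FR := [set u : FR | exists w : FR, u * w = 1].

Definition FR_inv (u : FR) : FR :=
  ([ffun i => (u.1 i)^-1], [ffun j => (u.2 j)^-1]).

Definition FR_N (u : FR) : R := (\prod_i u.1 i) * \prod_j cabs (u.2 j) ^+ 2.

(* The identity component of the unit group. *)
Definition FR_conn : set FR :=
  [set u : FR | (forall i, 0 < u.1 i) /\ (forall j, u.2 j != 0)].

Definition FR_conn0 : set FR := [set u : FR | FR_conn u /\ FR_N u = 1].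

Definition totally_positive : set F :=
  [set f | f != 0 /\ forall i, 0 < rplace P i f].

Definition positive_units : set F :=
  [set e | [/\ OF F e, OF F e^-1 & totally_positive e]].

(* Pairs (I, u); the genuine oriented divisors are those in [oDiv]. *)
Definition odivisor : Type := (set F * FR)%type.

Definition oDiv : set odivisor :=
  [set D : odivisor | fractional_ideal D.1 /\ FR_unit D.2].

Definition odiv_add (D E : odivisor) : odivisor :=
  (ideal_mul D.1 E.1, D.2 * E.2).

Definition odiv_opp (D : odivisor) : odivisor := (ideal_inv D.1, FR_inv D.2).

Definition odiv_sub (D E : odivisor) : odivisor := odiv_add D (odiv_opp E).

Definition odiv_deg (D : odivisor) : R :=
  - ln (ideal_norm R D.1) - \sum_(s : place) (pdeg s)%:R * ln (cabs (place_val D.2 s)).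

Definition oDiv0 : set odivisor := [set D : odivisor | oDiv D /\ odiv_deg D = 0].

Definition principal (f : F) : odivisor :=
  ([set f^-1 * x | x in OF F], FR_embed f).

(* The coset of D modulo principal oriented divisors. *)
Definition odiv_class (D : odivisor) : set odivisor :=
  [set odiv_add D (principal f) | f in [set f : F | f != 0]].

Definition oPic0 : set (set odivisor) := [set odiv_class D | D in oDiv0].

(* The minimum over the positive units is attained (only finitely many units
   give a bounded sum), so it is written as an infimum. *)
Definition Pic_norm (u : FR) : R :=
  Num.sqrt (inf [set \sum_(s : place)
      (pdeg s)%:R * cabs (Log (place_val u s * place_val (FR_embed e) s)) ^+ 2
    | e in positive_units]).

Definition field_degree : nat := \dim {:F}%VS.

Definition odiv_of_ideal (I : set F) : odivisor :=
  (I, FR_const (powR (ideal_norm R I) (- (field_degree%:R)^-1))).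

Definition strongly_reduced_ideal (C : R) (I : set F) : Prop :=
  [/\ fractional_ideal I,
      I 1,
      forall d : nat, (2 <= d)%N -> ~ I (d%:R^-1)
    & forall g, I g -> g != 0 -> FR_norm (FR_embed 1) <= C * FR_norm (FR_embed g)].

Definition Sred (C : R) : set odivisor :=
  [set odiv_of_ideal I | I in [set I | strongly_reduced_ideal C I]].

End Arakelov.
Arguments odiv_class {R F} P D.
Arguments oPic0 {R F} P.
Arguments Sred {R F} P C.

Definition delta (R : realType) (C : R) : R :=
  ln (1 + Num.sqrt 3 / (2 * C ^+ 2)).

(* Main.v *)
Require Import Defs.
From HB Require Import structures.
From mathcomp Require Import all_boot all_order all_algebra all_field.
From mathcomp Require Import finmap complex.
From mathcomp Require Import all_classical all_reals all_analysis.
From mathcomp Require Import ring lra.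

Set Implicit Arguments.
Unset Strict Implicit.
Unset Printing Implicit Defensive.

Import Order.TTheory GRing.Theory Num.Theory.
Import numFieldTopology.Exports numFieldNormedType.Exports.

Local Open Scope classical_set_scope.
Local Open Scope ring_scope.

(** Everything reduces to showing that [f = 1] when [I = f J] for strongly reduced
    ideals [I], [J] and some [t > 0] makes every [t sigma(f)] and its inverse closer
    than [eps = sqrt 3 / (2 C^2)] to [1].  If [f] is rational, primitivity of [1] in
    [I] and [J] forces [f = 1] or [f = -1], and closeness excludes [-1].  Otherwise
    [I] contains the rank-two lattice [Z f + Z], whose nonzero vectors have squared
    length at least [n / C^2]; Hermite's bound makes its Gram determinant at least
    [3/4 (n / C^2)^2], whereas closeness of [t f] to [1] makes [t^2] times that
    determinant less than [n^2 eps^2 = 3/4 (n / C^2)^2].  Hence [t < 1], and the same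
    argument for [f^-1] in [J] gives [t^-1 < 1], a contradiction.

    In (i), passing from [I J^-1 f^-1 = O_F] to [I = f J] requires that fractional
    ideals be invertible.  This, and the finiteness of the indices defining the norm,
    comes from a pigeonhole principle: a subgroup [A] of an [n]-dimensional rational
    space has at most [m^n] classes modulo [m A]. *)

(** * Principal logarithms: from a bound on [Log w] to a bound on [w - 1] *)

Section LogBound.
Variable R : realType.
Implicit Types (a th s x y : R) (w : R[i]).

Lemma is_derive_ge0_homo (f f' : R -> R) :
    (forall x, is_derive x 1 f (f' x)) -> (forall x, 0 <= x -> 0 <= f' x) ->
  forall x y, 0 <= x -> x <= y -> f x <= f y.
Proof.
move=> df f'_ge0 x y; apply: (ger0_derive1_ndecry (f := f) (a := 0)).
- by move=> z _; apply: ex_derive.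
- move=> z; rewrite in_itv /= andbT => /ltW z_ge0.
  by rewrite derive1E derive_val f'_ge0.
- apply: continuous_subspaceT; move=> z.
  exact/differentiable_continuous/derivable1_diffP/ex_derive.
Qed.

Lemma sin_le_id x : 0 <= x -> sin x <= x.
Proof.
move=> x_ge0.
have df (z : R) : is_derive z (1 : R) (fun z => z - sin z) (1 - cos z) by exact: is_deriveB.
have cos1 (z : R) : 0 <= z -> 0 <= 1 - cos z by rewrite subr_ge0 cos_le1.
have := is_derive_ge0_homo df cos1 (lexx 0) x_ge0.
by rewrite sin0 subr0 subr_ge0.
Qed.

(** On [x >= 0] the function [cos x + x^2 / 2] has derivative [x - sin x >= 0]; negative [x] follow
    by evenness. *)
Lemma cos_ge_parabola x : 1 - x ^+ 2 / 2 <= cos x.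
Proof.
wlog x_ge0 : x / 0 <= x => [Hx|].
  have [/Hx//|/ltW x_le0] := leP 0 x.
  by rewrite -cosN -sqrrN Hx // oppr_ge0.
have df (z : R) : is_derive z (1 : R) (fun z => cos z + z * z / 2) (z - sin z).
  by apply: is_derive_eq; rewrite /GRing.scale /=; field.
have dge (z : R) : 0 <= z -> 0 <= z - sin z by move=> z_ge0; rewrite subr_ge0 sin_le_id.
have := is_derive_ge0_homo df dge (lexx 0) x_ge0.
by rewrite cos0 mul0r mul0r addr0 lerBlDr expr2.
Qed.

(** The derivative is [2 (sinh x - x)], which starts at [0] and itself has derivative
    [2 (cosh x - 1) >= 0]. *)
Lemma expR_sub_parabola_homo x y : 0 <= x -> x <= y ->
  expR x + expR (- x) - x ^+ 2 <= expR y + expR (- y) - y ^+ 2.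
Proof.
have dexpN (z : R) : is_derive z (1 : R) (fun z => expR (- z)) (- expR (- z)).
  by apply: is_derive_eq; rewrite /GRing.scale /=; ring.
have dsinh (z : R) : is_derive z (1 : R) (fun z => expR z - expR (- z) - 2 * z)
    (expR z + expR (- z) - 2).
  by apply: is_derive_eq; rewrite /GRing.scale /=; ring.
have sinh_ge (z : R) : 0 <= z -> 0 <= expR z - expR (- z) - 2 * z.
  move=> z_ge0.
  have dge (t : R) : 0 <= t -> 0 <= expR t + expR (- t) - 2.
    by move=> _; have := expR_ge1Dx t; have := expR_ge1Dx (- t); lra.
  have := is_derive_ge0_homo dsinh dge (lexx 0) z_ge0.
  by rewrite oppr0 subrr mulr0 subrr.
move=> x_ge0 xy; rewrite !expr2.
have dcosh (z : R) : is_derive z (1 : R) (fun z => expR z + expR (- z) - z * z)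
    (expR z - expR (- z) - 2 * z).
  by apply: is_derive_eq; rewrite /GRing.scale /=; ring.
exact: (is_derive_ge0_homo dcosh sinh_ge).
Qed.

(* With [s ^+ 2 = a ^+ 2 + th ^+ 2] this is [|exp z - 1| <= exp |z| - 1] for
   [z = a + i th]. *)
Lemma polar_sub1_le a th s : 0 <= s -> a ^+ 2 + th ^+ 2 = s ^+ 2 ->
  (expR a * cos th - 1) ^+ 2 + (expR a * sin th) ^+ 2 <= (expR s - 1) ^+ 2.
Proof.
move=> s_ge0 s2; have as_le : `|a| <= s.
  by rewrite -ler_sqr ?nnegrE // real_normK ?num_real //; have := sqr_ge0 th; lra.
(* The two sides become [exp a (2 cosh a - 2 cos th)] and [exp s (2 cosh s - 2)], which are compared
   factor by factor. *)
have -> : (expR a * cos th - 1) ^+ 2 + (expR a * sin th) ^+ 2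
    = expR a * (expR a + expR (- a) - 2 * cos th).
  have -> : (expR a * cos th - 1) ^+ 2 + (expR a * sin th) ^+ 2
    = expR a * expR a * (cos th ^+ 2 + sin th ^+ 2) - 2 * expR a * cos th + 1
    by ring.
  by rewrite cos2Dsin2 mulrBr mulrDr expRxMexpNx_1; ring.
have -> : (expR s - 1) ^+ 2 = expR s * (expR s + expR (- s) - 2).
  by rewrite mulrBr mulrDr expRxMexpNx_1; ring.
have ea_cosh : expR a + expR (- a) = expR `|a| + expR (- `|a|).
  by case: (ger0P a) => // _; rewrite opprK addrC.
have := expR_sub_parabola_homo (normr_ge0 a) as_le.
rewrite -ea_cosh real_normK ?num_real // => h1.
(* Here [2 cosh a - a^2 <= 2 cosh s - s^2] and [2 cos th >= 2 - th^2]; the quadratic terms cancel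
   because [a^2 + th^2 = s^2]. *)
have h2 : expR a + expR (- a) - 2 * cos th <= expR s + expR (- s) - 2.
  by have := cos_ge_parabola th; lra.
apply: le_trans (ler_wpM2l (expR_ge0 a) h2) _.
have := expR_sub_parabola_homo (lexx 0) s_ge0.
rewrite oppr0 expR0 expr0n /= subr0 => h3.
apply: ler_wpM2r; first by have := sqr_ge0 s; lra.
by rewrite ler_expR (le_trans (ler_norm a)).
Qed.

Lemma cabsE w : cabs w = Num.sqrt (complex.Re w ^+ 2 + complex.Im w ^+ 2).
Proof. by case: w. Qed.

Lemma cabs_sqr w : cabs w ^+ 2 = complex.Re w ^+ 2 + complex.Im w ^+ 2.
Proof. by rewrite cabsE sqr_sqrtr // addr_ge0 ?sqr_ge0. Qed.

Lemma cabs_ge0 w : 0 <= cabs w.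
Proof. by rewrite cabsE sqrtr_ge0. Qed.

Lemma cabs_gt0 w : w != 0 -> 0 < cabs w.
Proof.
rewrite lt0r cabs_ge0 andbT; apply: contraNneq => w0.
exact/eqP/ComplexField.Normc.eq0_normc.
Qed.

Lemma cabsM w1 w2 : cabs (w1 * w2) = cabs w1 * cabs w2.
Proof. exact: ComplexField.Normc.normcM. Qed.

Lemma cabs1 : cabs (1 : R[i]) = 1.
Proof. exact: ComplexField.Normc.normc1. Qed.

Lemma cabsC x : cabs x%:C%C = `|x|.
Proof. by rewrite cabsE /= expr0n addr0 sqrtr_sqr. Qed.

Lemma cabs_leP w x : 0 <= x ->
  (cabs w <= x) = (complex.Re w ^+ 2 + complex.Im w ^+ 2 <= x ^+ 2).
Proof. by move=> x_ge0; rewrite -cabs_sqr ler_sqr // nnegrE cabs_ge0. Qed.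

Lemma Re_cos_Arg w : w != 0 -> complex.Re w = cabs w * cos (Arg w).
Proof.
move=> w_neq0; have c_gt0 := cabs_gt0 w_neq0.
have q_in : complex.Re w / cabs w \in `[-1, 1].
  rewrite in_itv /= -ler_norml normrM normfV (gtr0_norm c_gt0).
  rewrite ler_pdivrMr // mul1r -ler_sqr ?nnegrE ?cabs_ge0 //.
  by rewrite real_normK ?num_real // cabs_sqr lerDl sqr_ge0.
have -> : cos (Arg w) = complex.Re w / cabs w.
  by rewrite /Arg; case: ifP => _; rewrite ?cosN acosK.
by rewrite mulrC divfK ?gt_eqF.
Qed.

(** [sin (acos q)] is the nonnegative root of [1 - q^2] and so yields only [|Im w|]; the case
    distinction in [Arg] restores the sign. *)
Lemma Im_sin_Arg w : w != 0 -> complex.Im w = cabs w * sin (Arg w).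
Proof.
move=> w_neq0; have c_gt0 := cabs_gt0 w_neq0.
have /andP[q1 q2] : -1 <= complex.Re w / cabs w <= 1.
  rewrite -ler_norml normrM normfV (gtr0_norm c_gt0).
  rewrite ler_pdivrMr // mul1r -ler_sqr ?nnegrE ?cabs_ge0 //.
  by rewrite real_normK ?num_real // cabs_sqr lerDl sqr_ge0.
have E : `|complex.Im w| = cabs w * sin (acos (complex.Re w / cabs w)).
  have q_le1 : 0 <= 1 - (complex.Re w / cabs w) ^+ 2.
    by rewrite subr_ge0 -real_normK ?num_real // expr_le1 ?ler_norml ?q1.
  apply/eqP; rewrite sin_acos ?q1 // -(@eqrXn2 _ 2) ?mulr_ge0 ?sqrtr_ge0 ?cabs_ge0 //.
  rewrite exprMn sqr_sqrtr // real_normK ?num_real // mulrBr mulr1 -exprMn.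
  by rewrite (mulrC (cabs w) (_ / _)) divfK ?(gt_eqF c_gt0) // cabs_sqr addrAC subrr add0r.
rewrite /Arg; case: (ltP (complex.Im w) 0) E => [lt0|ge0] E.
  by rewrite sinN mulrN -E ltr0_norm // opprK.
by rewrite -E ger0_norm.
Qed.

(** This is [exp (a + i th)] with unrestricted [th]: products and inverses keep this form, whereas
    principal arguments do not add. *)
Definition polar a th : R[i] := (expR a * cos th +i* (expR a * sin th))%C.

Lemma polarM a1 a2 th1 th2 : polar a1 th1 * polar a2 th2 = polar (a1 + a2) (th1 + th2).
Proof.
apply/eqP; rewrite eq_complex /= expRD cosD sinD.
by apply/andP; split; apply/eqP; ring.
Qed.

Lemma polar0 : polar 0 0 = 1.
Proof. by rewrite /polar expR0 cos0 sin0 mulr1 mulr0. Qed.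

Lemma polar_neq0 a th : polar a th != 0.
Proof.
apply/negP => /eqP p0; have := polarM a (- a) th (- th).
by rewrite p0 mul0r !subrr polar0 => /esym/eqP; rewrite oner_eq0.
Qed.

Lemma polarV a th : (polar a th)^-1 = polar (- a) (- th).
Proof.
apply: (mulfI (polar_neq0 a th)).
by rewrite divff ?polar_neq0 // polarM !subrr polar0.
Qed.

Lemma cabs_polar_sub1_le a th s : 0 <= s -> a ^+ 2 + th ^+ 2 <= s ^+ 2 ->
  cabs (polar a th - 1) <= expR s - 1.
Proof.
move=> s_ge0 s2; pose t := Num.sqrt (a ^+ 2 + th ^+ 2).
have t2 : t ^+ 2 = a ^+ 2 + th ^+ 2 by rewrite sqr_sqrtr // addr_ge0 ?sqr_ge0.
have t_ge0 : 0 <= t by exact: sqrtr_ge0.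
have ts : t <= s by rewrite -ler_sqr ?nnegrE // t2.
have e1 : 1 <= expR t by have := expR_ge1Dx t; lra.
apply: le_trans (_ : expR t - 1 <= _); last by rewrite lerD2r ler_expR.
rewrite cabs_leP ?subr_ge0 //= subr0.
by apply: polar_sub1_le => //; rewrite t2.
Qed.

Lemma Log_polar w : w != 0 ->
  w = polar (complex.Re (Log w)) (complex.Im (Log w)).
Proof.
move=> w_neq0 /=; rewrite /polar /= lnK ?posrE ?cabs_gt0 //.
by rewrite -Re_cos_Arg // -Im_sin_Arg //; case: w {w_neq0}.
Qed.

(** [- Log w] is a logarithm of [w^-1] with the same modulus, so one estimate serves both. *)
Lemma cabs_sub1_lt w s : w != 0 -> cabs (Log w) < s ->
  cabs (w - 1) < expR s - 1 /\ cabs (w^-1 - 1) < expR s - 1.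
Proof.
move=> w_neq0; set c := cabs _ => cs; have c_ge0 : 0 <= c by exact: cabs_ge0.
have c2 := cabs_sqr (Log w); rewrite -/c in c2.
have lt_e : expR c - 1 < expR s - 1 by rewrite ltrD2r ltr_expR.
rewrite (Log_polar w_neq0) polarV.
split; apply: le_lt_trans lt_e; apply: cabs_polar_sub1_le => //.
  by rewrite c2.
by rewrite !sqrrN c2.
Qed.

(** [Log w1 - Log w2] may fail to be the principal logarithm of [w1 / w2], but it is a logarithm,
    and the triangle inequality keeps its modulus below [s]. *)
Lemma cabs_div_sub1_lt w1 w2 s : w1 != 0 -> w2 != 0 ->
  cabs (Log w1) < 2^-1 * s -> cabs (Log w2) < 2^-1 * s ->
  cabs (w1 / w2 - 1) < expR s - 1.
Proof.
move=> w1_neq0 w2_neq0; set c1 := cabs _; set c2 := cabs _ => c1s c2s.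
have c12_ge0 : 0 <= c1 + c2 by rewrite addr_ge0 ?cabs_ge0.
have lt_e : expR (c1 + c2) - 1 < expR s - 1 by rewrite ltrD2r ltr_expR; lra.
apply: le_lt_trans lt_e.
rewrite [w1 in w1 / _]Log_polar // [w2 in _ / w2]Log_polar // polarV polarM.
apply: cabs_polar_sub1_le => //.
have := le_normcD (Log w1) (- Log w2).
rewrite normcN -/(cabs _) -/(cabs _) -/c1 -/c2.
by rewrite -/(cabs _) cabs_leP.
Qed.

End LogBound.

(** * Hermite's lower bound for the determinant of a binary quadratic form *)

Section Hermite.
Variable R : realType.

Definition binary_form (A B C x y : R) := A * x ^+ 2 + 2 * B * x * y + C * y ^+ 2.

(* Hermite's bound: among the forms of given discriminant [A C - B ^ 2] whose
   values at nonzero integral points are at least [mu], one with nearly minimal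
   leading coefficient becomes reduced after a shear. *)
Lemma hermite_bound (A B C mu : R) : 0 < mu ->
    (forall x y : int, (x != 0) || (y != 0) -> mu <= binary_form A B C x%:~R y%:~R) ->
  3 / 4 * mu ^+ 2 <= A * C - B ^+ 2.
Proof.
move=> mu_gt0 ABC_ge; set D := A * C - B ^+ 2.
pose good A' B' C' := A' * C' - B' ^+ 2 = D /\
  forall x y : int, (x != 0) || (y != 0) -> mu <= binary_form A' B' C' x%:~R y%:~R.
pose S := [set A' | exists B' C', good A' B' C'].
have S_ge A' : S A' -> mu <= A'.
  case=> B' [C' [_ /(_ 1 0 isT)]].
  by rewrite /binary_form mulr1 mulr0 expr1n expr0n /= !mulr0 !addr0 mulr1.
have SA : S A by exists B, C.
have Slb : has_inf S by split; [exists A | exists mu => x /S_ge].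
have inf_ge : mu <= inf S by apply: lb_le_inf; [exists A | move=> x /S_ge].
have inf_gt0 : 0 < inf S by lra.
(* The tolerance is [inf S] itself, so [A1 < 2 inf S]. *)
have [A1 [B1 [C1 [D1 good1]]] A1_lt] := inf_adherent inf_gt0 Slb.
have A1_ge : inf S <= A1 by apply: ge_inf; [exact: Slb.2 | exists B1, C1].
have A1_gt0 : 0 < A1 by lra.
(* The integer nearest to [B1 / A1] is the shear that brings the middle coefficient down to at most
   [A1 / 2]. *)
pose k := Num.floor (B1 / A1 + 2^-1); pose B2 := B1 - k%:~R * A1.
have B2_le : `|B2| <= A1 / 2.
  have /andP[k1 k2] := floor_itv (B1 / A1 + 2^-1); rewrite -/k in k1 k2.
  have eB : B1 = (B1 / A1) * A1 by rewrite divfK ?gt_eqF.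
  have -> : B2 = (B1 / A1 - k%:~R) * A1 by rewrite mulrBl -eB.
  rewrite normrM (gtr0_norm A1_gt0) mulrC; apply: ler_wpM2l; first exact: ltW.
  rewrite intrD in k2; rewrite ler_norml; apply/andP; split; lra.
pose C2 := C1 - 2 * k%:~R * B1 + k%:~R ^+ 2 * A1.
(* Exchanging the variables after the shear makes [C2] a leading coefficient as well, hence at least
   [inf S]. *)
have SC2 : S C2.
  exists B2, A1; split; first by rewrite -D1 /B2 /C2; ring.
  move=> x y xy; have -> : binary_form C2 B2 A1 x%:~R y%:~R
      = binary_form A1 B1 C1 (y - k * x)%:~R x%:~R.
    by rewrite /binary_form /C2 /B2 intrB intrM; ring.
  apply: good1; case: (eqVneq x 0) xy => [->|] /=; last by rewrite orbT.
  by rewrite mulr0 subr0 orbF.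
have C2_ge : inf S <= C2 by apply: ge_inf; [exact: Slb.2 | ].
have -> : D = A1 * C2 - B2 ^+ 2 by rewrite -D1 /C2 /B2; ring.
have B2_sqr : B2 ^+ 2 <= (A1 / 2) ^+ 2.
  by rewrite -[B2 ^+ 2]real_normK ?num_real // ler_sqr ?nnegrE ?normr_ge0 //; lra.
have h1 : A1 * inf S <= A1 * C2 by apply: ler_wpM2l => //; apply: ltW.
(* With [m = inf S] the product is [4 A1 m - A1^2 - 3 m^2], so [A1 m - A1^2 / 4 >= 3/4 m^2]. *)
have h2 : 0 <= (A1 - inf S) * (3 * inf S - A1) by apply: mulr_ge0; lra.
have h3 : mu ^+ 2 <= inf S ^+ 2 by rewrite ler_sqr ?nnegrE ?normr_ge0 //; lra.
move: B2_sqr h2 h3; rewrite !expr2; lra.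
Qed.

End Hermite.

(** * Classes of a subgroup of a rational vector space modulo an integer *)

Section Pigeonhole.
Local Open Scope nat_scope.

Lemma nat_pigeonhole (T : finType) (g : nat -> T) (N : nat) :
  #|T| < N -> exists i j, [/\ i < j, j < N & g i = g j].
Proof.
move=> card_lt; have /injectivePn[i [j neq_ij eq_g]] : ~~ injectiveb (fun i : 'I_N => g i).
  apply: contraL card_lt => /injectiveP g_inj; rewrite -leqNgt.
  by have := leq_card _ g_inj; rewrite card_ord.
have [lt_ij|lt_ji|eq_ij] := ltngtP i j.
- by exists i, j; split=> //; exact: ltn_ord.
- by exists j, i; split=> //; exact: ltn_ord.
- by rewrite (val_inj eq_ij) eqxx in neq_ij.
Qed.
End Pigeonhole.

Section SubgroupPigeonhole.
Import VectorInternalTheory.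
Variables (V : vectType rat) (A : set V).
Hypotheses (A0 : A 0) (AB : forall x y, A x -> A y -> A (x - y)).

Let AN x : A x -> A (- x).
Proof. by move=> Ax; rewrite -sub0r; apply: AB. Qed.

Let AD x y : A x -> A y -> A (x + y).
Proof. by move=> Ax Ay; rewrite -[y]opprK; apply: AB => //; apply: AN. Qed.

Let Asum (I : Type) (s : seq I) (Q : pred I) (f : I -> V) :
  (forall i, A (f i)) -> A (\sum_(i <- s | Q i) f i).
Proof. by move=> Af; elim/big_ind: _. Qed.

Let AMz x (z : int) : A x -> A (x *~ z).
Proof.
have AMn n : A x -> A (x *+ n).
  by move=> Ax; elim: n => [|n IHn]; rewrite ?mulr0n // mulrS; apply: AD.
by case: z => n Ax; [apply: AMn | apply/AN/AMn].
Qed.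

(* A finitely generated subgroup of an [n]-dimensional rational space is
   generated by [n] elements (Smith form), so it has at most [m ^ n] classes
   modulo [m]. *)
Lemma subgroup_pigeonhole (m : nat) (a : nat -> V) : (0 < m)%N ->
    (forall i, A (a i)) ->
  exists i j y, [/\ (i < j)%N, (j <= m ^ dim V)%N, A y & a i = a j + y *+ m].
Proof.
case: m => // m _ Aa; set n := dim V; set N := (m.+1 ^ n)%N.
pose X : 'M[rat]_(N.+1, n) := \matrix_(i, j) v2r (a i) 0 j.
(* A common denominator, turning the coordinates of the [N + 1] vectors into an integer matrix. *)
pose D : rat := \prod_(ij : 'I_N.+1 * 'I_n) (denq (X ij.1 ij.2))%:~R.
have D_neq0 : D != 0.
  by apply/prodf_neq0 => ij _; rewrite intr_eq0 denq_eq0.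
pose M : 'M[int]_(N.+1, n) := \matrix_(i, j) numq (D * X i j).
have ME i j : (M i j)%:~R = D * X i j.
  rewrite mxE numqK // /D (bigD1 (i, j)) //= mulrAC rpredM ?rpred_prod //.
    by rewrite mulrC -numqE; apply: intr_int.
  by move=> ij _; apply: intr_int.
have [L Lunit [Q _ [d _ defM]]] := int_Smith_normal_form M.
pose K := invmx L.
pose e (k : 'I_N.+1) := \sum_(i < N.+1) a i *~ K k i.
have Ae k : A (e k) by apply: Asum => i; apply: AMz.
have aE (i : 'I_N.+1) : a i = \sum_(k < N.+1) e k *~ L i k.
  rewrite /e; under eq_bigr => k _ do rewrite mulrz_suml.
  rewrite exchange_big /=.
  have LK1 := mulmxV Lunit.
  rewrite (bigD1 i) //= [X in _ + X]big1 => [|j neq_ji].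
    under eq_bigr => k _ do rewrite -mulrzA mulrC.
    rewrite -mulrz_sumr addr0.
    have := congr1 (fun B : 'M[int]_(N.+1) => B i i) LK1.
    by rewrite !mxE eqxx => ->; rewrite mulr1z.
  under eq_bigr => k _ do rewrite -mulrzA mulrC.
  rewrite -mulrz_sumr.
  have := congr1 (fun B : 'M[int]_(N.+1) => B i j) LK1.
  by rewrite !mxE eq_sym (negPf neq_ji) => ->; rewrite mulr0z.
(* [K M] is a diagonal matrix with [n] columns times [Q], so its rows from index [n] on vanish and
   at most [n] generators remain. *)
have e0 (k : 'I_N.+1) : (n <= k)%N -> e k = 0.
  move=> le_nk; apply: (can_inj v2rK); rewrite linear0; apply/rowP => j.
  apply: (mulfI D_neq0); rewrite [X in _ = D * X]mxE mulr0 /e linear_sum summxE mulr_sumr.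
  have := congr1 (fun B => (K *m B) k j) defM.
  rewrite -mulmxA mulKmx // [RHS]mxE [RHS]big1; last first.
    move=> i _; rewrite mxE; case: eqP => [eq_ki|]; last by rewrite mulr0n mul0r.
    by rewrite eq_ki leqNgt ltn_ord in le_nk.
  rewrite mxE => /(congr1 (fun z : int => z%:~R : rat)); rewrite rmorph_sum /=.
  move=> M0; rewrite -[RHS]M0.
  apply: eq_bigr => i _; rewrite intrM ME mxE raddfMz /= -scaler_int mxE; ring.
(* Residues of the [n] remaining coordinates: [N] patterns for [N + 1] vectors. *)
pose g i := [ffun k : 'I_n => inord `|(L (inord i) (inord k) %% m.+1%:Z)%Z|%N : 'I_m.+1].
have card_g : (#|{: {ffun 'I_n -> 'I_m.+1}}| < N.+1)%N by rewrite card_ffun !card_ord.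
have [i [j [lt_ij lt_jN eq_g]]] := nat_pigeonhole g card_g.
pose q (k : 'I_N.+1) := ((L (inord i) k - L (inord j) k) %/ m.+1%:Z)%Z.
exists i, j, (\sum_k e k *~ q k); split=> //; first by apply: Asum => k; apply: AMz.
have lt_iN : (i < N.+1)%N := ltn_trans lt_ij lt_jN.
have := aE (inord i); have := aE (inord j); rewrite !inordK // => -> ->.
rewrite pmulrn mulrz_suml -big_split /=; apply: eq_bigr => k _.
have [le_nk|lt_kn] := leqP n k; first by rewrite e0 // !mul0rz addr0.
have mod_lt z : (`|(z %% m.+1%:Z)%Z|%N < m.+1)%N.
  by rewrite -ltz_nat gez0_abs ?modz_ge0 // ltz_pmod.
have dvd_L : (m.+1%:Z %| L (inord i) k - L (inord j) k)%Z.
  rewrite -eqz_mod_dvd; apply/eqP.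
  have := congr1 (fun h : {ffun 'I_n -> 'I_m.+1} => val (h (Ordinal lt_kn))) eq_g.
  rewrite !ffunE /= !inordK ?mod_lt // inord_val.
  by move/(congr1 Posz); rewrite !gez0_abs ?modz_ge0.
rewrite -mulrzA -mulrzDr /q divzK //.
by rewrite (addrC (L (inord j) k)) subrK.
Qed.
End SubgroupPigeonhole.

(** Supplies the decreasing measure for the induction in [integral_ideal_invertible]. *)
Lemma sub_count_lt (T : eqType) (a b : pred T) (s : seq T) y :
  subpred a b -> y \in s -> b y -> ~~ a y -> (count a s < count b s)%N.
Proof.
move=> sub_ab; elim: s => //= z s IHs; rewrite inE => /orP[/eqP<-|sy] b_y na_y.
  by rewrite (negPf na_y) b_y add0n add1n ltnS; apply: sub_count.
rewrite -addnS leq_add ?IHs //.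
by case: (a z) (sub_ab z) => // ->.
Qed.

(** * Fractional ideals: inverses and positivity of the norm *)

Section Ideals.
Variable F : fieldExtType rat.
Implicit Types (I J A : set F) (x y z c : F).

Lemma intr_fieldExt_eq0 (k : int) : ((k%:~R : F) == 0) = (k == 0).
Proof. by rewrite -(rmorph_int (in_alg F)) fmorph_eq0 intr_eq0. Qed.

Lemma natr_fieldExt_eq0 (n : nat) : ((n%:R : F) == 0) = (n == 0)%N.
Proof. exact: (intr_fieldExt_eq0 n). Qed.

Lemma OF_int (k : int) : OF F k%:~R.
Proof. exact: integral_id. Qed.

Lemma OF_nat (n : nat) : OF F n%:R.
Proof. exact: (OF_int n). Qed.

Lemma OF1 : OF F 1.
Proof. exact: (OF_nat 1). Qed.

Lemma OF0 : OF F 0.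
Proof. exact: (OF_nat 0). Qed.

Lemma OFD x y : OF F x -> OF F y -> OF F (x + y).
Proof. exact: integral_add. Qed.

Lemma OFB x y : OF F x -> OF F y -> OF F (x - y).
Proof. exact: integral_sub. Qed.

Lemma OFM x y : OF F x -> OF F y -> OF F (x * y).
Proof. exact: integral_mul. Qed.

Lemma OFX x n : OF F x -> OF F (x ^+ n).
Proof.
by move=> Ox; elim: n => [|n IHn]; rewrite ?expr0 ?exprS; [exact: OF1 | exact: OFM].
Qed.

(** From an integer polynomial vanishing at [d], factors [X] are stripped until the constant term
    [c] is nonzero; then [c = - p(d) d] with [p(d)] integral. *)
Lemma OF_multiple_int d : OF F d -> d != 0 ->
  exists (m : nat) (q : F), [/\ (0 < m)%N, OF F q & d * q = m%:R].
Proof.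
move=> Od d_neq0; have [p p_monic /eqP] := Od.
have : p != 0 by rewrite monic_neq0.
have Ohorner (q : {poly int}) : OF F (map_poly intr q).[d].
  elim/poly_ind: q => [|q c IHq]; first by rewrite rmorph0 horner0; exact: OF0.
  rewrite rmorphD rmorphM /= map_polyX map_polyC hornerD hornerM hornerX hornerC.
  by apply: OFD; [exact: OFM | exact: OF_int].
elim/poly_ind: p {p_monic} => [|p c IHp]; first by rewrite eqxx.
rewrite rmorphD rmorphM /= map_polyX map_polyC hornerD hornerM hornerX hornerC.
have [->|c_neq0] := eqVneq c 0.
  rewrite !rmorph0 !addr0 => pX_neq0 /eqP; rewrite mulf_eq0 (negPf d_neq0) orbF.
  move/eqP; apply: IHp; apply: contraNneq pX_neq0 => ->; by rewrite mul0r.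
move=> _ /eqP; rewrite addr_eq0 => /eqP E.
exists `|c|%N, (- (Num.sg c)%:~R * (map_poly intr p).[d]); split.
- by rewrite absz_gt0.
- by apply: OFM => //; rewrite -rmorphN; exact: OF_int.
- rewrite mulrCA [d * _]mulrC E mulrNN -rmorphM /=.
  by rewrite pmulrn abszE normrEsg.
Qed.

(** These are the [O_F]-submodules of [F], integral or not. *)
Definition ring_ideal I := [/\ I 0, forall x y, I x -> I y -> I (x + y)
  & forall a x, OF F a -> I x -> I (a * x)].

Lemma ring_idealB I x y : ring_ideal I -> I x -> I y -> I (x - y).
Proof.
move=> [_ ID IM] Ix Iy; apply: ID => //; rewrite -mulN1r.
by apply: IM => //; exact: (OF_int (-1)).
Qed.

Lemma fractional_ring_ideal I : fractional_ideal I -> ring_ideal I.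
Proof.
case=> ID IM [x Ix _] _; split=> //; rewrite -(mul0r x).
by apply: IM => //; exact: OF0.
Qed.

(** Without a finite list of representatives, pairwise incongruent elements could be listed to any
    length, contradicting [subgroup_pigeonhole]. *)
Lemma subgroup_representatives A (m : nat) : (0 < m)%N -> A 0 ->
    (forall x y, A x -> A y -> A (x - y)) ->
  exists s : seq F, (forall x, x \in s -> A x) /\
    forall x, A x -> exists y z, [/\ y \in s, A z & x = y + z *+ m].
Proof.
move=> m_gt0 A0 AB; apply: contrapT => no_reps.
pose congr_mod x y := exists2 z, A z & x = y + z *+ m.
have free_seq k : exists s : seq F, [/\ size s = k, forall x, x \in s -> A x
    & forall i j, (i < j < k)%N -> ~ congr_mod s`_i s`_j].
  elim: k => [|k [s [size_s sA s_free]]].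
    by exists [::]; split=> // i j; rewrite ltn0 andbF.
  have [x Ax xs] : exists2 x, A x & forall y, y \in s -> ~ congr_mod x y.
    apply: contrapT => no_x; apply: no_reps; exists s; split=> // x Ax.
    apply: contrapT => no_yz; apply: no_x; exists x => // y sy [z Az def_x].
    by apply: no_yz; exists y, z.
  exists (x :: s); split=> /=; first by rewrite size_s.
    by move=> y; rewrite inE => /orP[/eqP->|/sA].
  move=> [|i] [|j] //=; rewrite ltnS ?ltnS; last exact: s_free.
  by move=> lt_jk; apply: xs; rewrite mem_nth ?size_s.
have [s [size_s sA s_free]] := free_seq (m ^ dim F).+1.
have nthA i : A s`_i.
  have [lt_i|le_i] := ltnP i (size s); first by apply/sA/mem_nth.
  by rewrite nth_default.
have [i [j [z [lt_ij le_j Az def_i]]]] := subgroup_pigeonhole A0 AB m_gt0 nthA.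
by apply: (s_free i j); rewrite ?lt_ij ?ltnS //; exists z.
Qed.

Section ProperIdeal.
Variables (I : set F) (m : nat).
Hypotheses (I_ideal : ring_ideal I) (I_int : forall x, I x -> OF F x).
Hypotheses (m_gt0 : (0 < m)%N) (Im : I m%:R).

Let multiple x := exists2 z, OF F z & x = z *+ m.

Let multipleM x y : OF F x -> multiple y -> multiple (x * y).
Proof. by move=> Ox [z Oz ->]; exists (x * z); [exact: OFM | rewrite mulrnAr]. Qed.

Let multipleD x y : multiple x -> multiple y -> multiple (x + y).
Proof.
by move=> [z Oz ->] [t Ot ->]; exists (z + t); [exact: OFD | rewrite mulrnDl].
Qed.

(** The quotient [c / m] will be a nonintegral element of the inverse of [I]. In [O_F / m] localised
    at [1 + I] every element of [I] is nilpotent, so multiplying by powers of finitely many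
    representatives yields a [c] that kills them all without vanishing. *)
Lemma proper_ideal_annihilator : ~ I 1 ->
  exists c, [/\ OF F c, ~ multiple c & forall i, I i -> multiple (c * i)].
Proof.
have [I0 ID IM] := I_ideal; move=> I1.
(* [c] survives in the localisation of [O_F / m] at [1 + I]. *)
pose survives c := forall b, I (b - 1) -> ~ multiple (b * c).
have OF1I b : I (b - 1) -> OF F b.
  by move=> /I_int /OFD /(_ OF1); rewrite subrK.
have kill_seq (s : seq F) : (forall i, i \in s -> I i) ->
    exists c, [/\ OF F c, survives c & forall i, i \in s -> multiple (c * i)].
  elim: s => [_|i s IHs sI].
    exists 1; split=> //; first exact: OF1.
    move=> b Ib; rewrite mulr1 => -[z Oz def_b]; apply: I1.
    rewrite -(subKr b 1); apply: ring_idealB => //.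
    by rewrite def_b -mulr_natr; apply: IM.
  have Ii : I i by apply: sI; rewrite mem_head.
  have [|c [Oc c_surv c_kill]] := IHs; first by move=> j sj; apply: sI; rewrite inE sj orbT.
  have Oi := I_int Ii.
  (* Two powers of [i] agree modulo [m]; then [1 - i^(l - k)] lies in [1 + I] and sends [c * i^k] to
     a multiple of [m]. *)
  have dies : exists e, `[< ~ survives (c * i ^+ e) >].
    have [k [l [y [lt_kl _ Oy def_ik]]]] :=
      subgroup_pigeonhole OF0 OFB m_gt0 (fun e => OFX e Oi).
    exists k; apply/asboolP => /(_ (1 - i ^+ (l - k))); apply.
      rewrite addrAC subrr add0r -mulN1r; apply: (IM); first exact: (OF_int (-1)).
      case: (l - k)%N (subn_gt0 k l) => [|e _]; first by rewrite lt_kl.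
      by rewrite exprSr; apply: IM => //; apply: OFX.
    rewrite mulrCA mulrBl mul1r -exprD subnK ?(ltnW lt_kl) // def_ik addrAC subrr add0r.
    by apply: multipleM => //; exists y.
  (* At the least exponent [e + 1] that dies, [c * i^e] still survives, and some [b] in [1 + I]
     makes [b * c * i^e] a survivor killed by [i]. *)
  case: (ex_minnP dies) => e /asboolP e_dies e_min.
  case: e e_dies e_min => [|e] e_dies e_min; first by rewrite expr0 mulr1 in e_dies.
  have e_surv : survives (c * i ^+ e).
    by apply: contrapT => /asboolP /e_min; rewrite ltnn.
  have [b [Ib b_mul]] : exists b, I (b - 1) /\ multiple (b * (c * i ^+ e.+1)).
    by apply: contrapT => no_b; apply: e_dies => b Ib b_mul; apply: no_b; exists b.
  have Ob := OF1I _ Ib; have Obie : OF F (b * i ^+ e) by apply/OFM/OFX.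
  exists (b * (c * i ^+ e)); split.
  - by apply: OFM => //; apply/OFM/OFX.
  - move=> b' Ib'; rewrite mulrA; apply: e_surv.
    have -> : b' * b - 1 = b * (b' - 1) + (b - 1) by ring.
    by apply: ID => //; apply: IM.
  move=> j; rewrite inE => /orP[/eqP->|/c_kill cj_mul].
    by rewrite -mulrA -mulrA -exprSr.
  have -> : b * (c * i ^+ e) * j = (b * i ^+ e) * (c * j) by ring.
  exact: multipleM.
have [s [sI s_reps]] := subgroup_representatives m_gt0 I0
  (fun x y => ring_idealB I_ideal (x := x) (y := y)).
have [c [Oc c_surv c_kill]] := kill_seq s sI.
exists c; split=> //.
  by move=> c_mul; apply: (c_surv 1); rewrite ?subrr // mul1r.
move=> i Ii; have [y [z [sy Iz ->]]] := s_reps i Ii.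
rewrite mulrDr; apply: multipleD; first exact: c_kill.
by apply: multipleM => //; exists z => //; apply: I_int.
Qed.

Lemma proper_ideal_inv_nonintegral : ~ I 1 -> exists x, ~ OF F x /\ ideal_inv I x.
Proof.
move=> /proper_ideal_annihilator[c [Oc c_mul c_kill]].
have m_neq0 : (m%:R : F) != 0 by rewrite natr_fieldExt_eq0 -lt0n.
exists (c / m%:R); split.
  by move=> Ocm; apply: c_mul; exists (c / m%:R) => //; rewrite -[RHS]mulr_natr divfK.
move=> i /c_kill[z Oz]; rewrite -(mulr_natr z) => czm.
by rewrite mulrAC czm mulfK.
Qed.

(* The powers of such an [x] lie in the group [m^-1 O_F], so two of them differ
   by an element of [O_F]. *)
Lemma ideal_stabilizer_integral x : (forall i, I i -> I (x * i)) -> OF F x.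
Proof.
move=> xI; pose A := [set y : F | OF F (y *+ m)].
have A0 : A 0 by rewrite /A /= mul0rn; exact: OF0.
have AB y z : A y -> A z -> A (y - z) by rewrite /A /= mulrnBl; exact: OFB.
have xA k : A (x ^+ k).
  rewrite /A /= -mulr_natr; apply: I_int; elim: k => [|k IHk].
    by rewrite expr0 mul1r.
  by rewrite exprS -mulrA; apply: xI.
have [k [l [y [lt_kl _ Ay def_xk]]]] := subgroup_pigeonhole A0 AB m_gt0 xA.
(* [X^l - q] is monic because [k < l], has coefficients in [O_F] and vanishes at [x]. *)
pose q : {poly F} := 'X^k - (y *+ m)%:P.
have size_q : (size q < size ('X^l : {poly F}))%N.
  rewrite size_polyXn ltnS; apply: leq_trans (size_polyD _ _) _.
  rewrite size_polyN size_polyXn geq_max lt_kl /=.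
  by apply: leq_trans (size_polyC_leq1 _) _; apply: leq_trans lt_kl.
apply: (@integral_root_monic _ _ _ _ ('X^l - q)).
- by rewrite monicE lead_coefDl ?size_polyN // lead_coefXn.
- by rewrite rootE !hornerE def_xk addrK subrr.
apply/integral_poly => i; rewrite !coefB coefXn coefXn coefC.
apply: OFB; first exact: OF_nat.
apply: OFB; first exact: OF_nat.
by case: ifP => _; [exact: Ay | exact: OF0].
Qed.

End ProperIdeal.

Lemma ideal_mul_gen I J x y : I x -> J y -> ideal_mul I J (x * y).
Proof.
move=> Ix Jy; exists [:: (x, y)]; split; last by rewrite big_seq1.
by move=> p; rewrite inE => /eqP->.
Qed.

Lemma ideal_mul0 I J : ideal_mul I J 0.
Proof. by exists [::]; split=> //; rewrite big_nil. Qed.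

Lemma ideal_mulD I J x y :
  ideal_mul I J x -> ideal_mul I J y -> ideal_mul I J (x + y).
Proof.
move=> [s [sIJ ->]] [t [tIJ ->]]; exists (s ++ t); split; last by rewrite big_cat.
by move=> p; rewrite mem_cat => /orP[/sIJ|/tIJ].
Qed.

Lemma ideal_mul_ind I J (K : set F) : K 0 -> (forall x y, K x -> K y -> K (x + y)) ->
  (forall x y, I x -> J y -> K (x * y)) -> ideal_mul I J `<=` K.
Proof.
move=> K0 KD KM x [s [sIJ ->]]; rewrite big_seq; elim/big_ind: _ => //.
by move=> p /sIJ[Ip Jp]; apply: KM.
Qed.

(** Induction on the number of representatives of [O_F] modulo [m] that [I] misses. If [1] is not in
    [I], a nonintegral [x] in the inverse enlarges [I] to the integral ideal [I + x I], whose
    invertibility passes back to [I]. *)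
Lemma integral_ideal_invertible (m : nat) I : (0 < m)%N -> ring_ideal I ->
  (forall x, I x -> OF F x) -> I m%:R -> ideal_mul I (ideal_inv I) 1.
Proof.
move=> m_gt0; have [s [_ s_reps]] := subgroup_representatives m_gt0 OF0 OFB.
pose missing I := count (fun y => `[< ~ I y >]) s.
have [k] := ubnP (missing I); elim: k I => // k IHk I lt_k I_ideal I_int Im.
have [I0 ID IM] := I_ideal.
have [I1|I1] := pselect (I 1).
  by rewrite -(mulr1 1); apply: ideal_mul_gen => // i /I_int; rewrite mul1r.
have [x [x_nint x_inv]] := proper_ideal_inv_nonintegral I_ideal I_int m_gt0 Im I1.
(* If [x I] lay in [I], then [x] would be integral. *)
have [i0 Ii0 Ixi0] : exists2 i, I i & ~ I (x * i).
  apply: contrapT => no_i; apply: x_nint.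
  apply: (ideal_stabilizer_integral I_int m_gt0 Im) => i Ii.
  by apply: contrapT => Ixi; apply: no_i; exists i.
pose I' := [set y | exists i j, [/\ I i, I j & y = i + x * j]].
have II' y : I y -> I' y by move=> Iy; exists y, 0; rewrite mulr0 addr0.
have I'_ideal : ring_ideal I'.
  split; first exact: II'.
    move=> _ _ [i [j [Ii Ij ->]]] [i' [j' [Ii' Ij' ->]]].
    by exists (i + i'), (j + j'); split; [exact: ID | exact: ID | ring].
  move=> a _ Oa [i [j [Ii Ij ->]]].
  by exists (a * i), (a * j); split; [exact: IM | exact: IM | ring].
have I'_int y : I' y -> OF F y.
  by move=> [i [j [Ii Ij ->]]]; apply: OFD; [exact: I_int | exact: x_inv].
have lt_missing : (missing I' < missing I)%N.
  (* The representative of [x * i0] lies in [I'] but not in [I], since both ideals contain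
     [m O_F]. *)
  have [y [z [sy Oz def_xi]]] := s_reps _ (x_inv _ Ii0).
  have zm_in K : ring_ideal K -> K m%:R -> K (z *+ m).
    by move=> [_ _ KM] Km; rewrite -mulr_natr; exact: KM.
  have Iy : ~ I y by move=> Iy; apply: Ixi0; rewrite def_xi; apply: ID => //; exact: zm_in.
  have I'y : I' y.
    have -> : y = x * i0 - z *+ m by rewrite def_xi addrK.
    apply: ring_idealB => //; last by apply: zm_in => //; apply: II'.
    by exists 0, i0; rewrite add0r.
  apply: (@sub_count_lt _ _ _ _ y) => //; last 2 first.
  - exact/asboolP.
  - by apply/asboolPn => nI'y; exact: nI'y.
  by move=> t /asboolP nI't; apply/asboolP => It; apply/nI't/II'.
have /IHk := leq_trans lt_missing (ltnSE lt_k).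
move=> /(_ I'_ideal I'_int (II' _ Im)).
apply: ideal_mul_ind; [exact: ideal_mul0 | by move=> *; exact: ideal_mulD | ].
move=> _ z [i [j [Ii Ij ->]]] I'z.
(* For [z] in the inverse of [I'], both [z] and [x * z] lie in the inverse of [I]. *)
have -> : (i + x * j) * z = i * z + j * (x * z) by ring.
apply: ideal_mulD; apply: ideal_mul_gen => // t It.
  by apply/I'z/II'.
rewrite mulrAC mulrC; apply: I'z; exists 0, t; split=> //.
by rewrite add0r.
Qed.

Lemma fractional_ideal_multiple (I : set F) : fractional_ideal I ->
  exists m : nat, (0 < m)%N /\ forall x, I x -> OF F (x *+ m).
Proof.
move=> [_ _ _ [d [Od d_neq0 dI]]].
have [m [q [m_gt0 Oq dq]]] := OF_multiple_int Od d_neq0.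
exists m; split=> // x Ix; rewrite -mulr_natl -dq mulrAC mulrC.
by apply: OFM => //; apply: dI.
Qed.

Lemma fractional_ideal_contains_nat (I : set F) : fractional_ideal I ->
  exists m : nat, (0 < m)%N /\ I m%:R.
Proof.
move=> [_ IM [x Ix x_neq0] [d [Od d_neq0 dI]]].
have dx_neq0 : d * x != 0 by rewrite mulf_neq0.
have [m [q [m_gt0 Oq dq]]] := OF_multiple_int (dI _ Ix) dx_neq0.
exists m; split=> //; rewrite -dq mulrAC; apply: IM => //.
exact: OFM.
Qed.

(** The multiple [k I] is integral, hence invertible; the factor [k] is then moved from the element
    of [I] to that of the inverse. *)
Lemma fractional_ideal_invertible (I : set F) :
  fractional_ideal I -> ideal_mul I (ideal_inv I) 1.
Proof.
move=> I_frac; have [k [k_gt0 kI]] := fractional_ideal_multiple I_frac.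
have k_neq0 : (k%:R : F) != 0 by rewrite natr_fieldExt_eq0 -lt0n.
have [m [m_gt0 Im]] := fractional_ideal_contains_nat I_frac.
have [I0 ID IM] := fractional_ring_ideal I_frac.
pose K := [set x *+ k | x in I].
have K_ideal : ring_ideal K.
  split; first by exists 0 => //; rewrite mul0rn.
    move=> _ _ [x Ix <-] [y Iy <-]; exists (x + y); last by rewrite mulrnDl.
    exact: ID.
  move=> a _ Oa [x Ix <-]; exists (a * x); last by rewrite mulrnAr.
  exact: IM.
have K_int x : K x -> OF F x by move=> [y /kI Oky <-].
have Kmk : K (m * k)%:R by exists m%:R => //; rewrite -mulrnA.
have km_gt0 : (0 < m * k)%N by rewrite muln_gt0 m_gt0.
have := integral_ideal_invertible km_gt0 K_ideal K_int Kmk.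
apply: ideal_mul_ind; [exact: ideal_mul0 | by move=> *; exact: ideal_mulD | ].
move=> _ y [x Ix <-] Ky.
rewrite mulrnAl -mulrnAr; apply: ideal_mul_gen => // z Iz.
by rewrite mulrnAl -mulrnAr; apply: Ky; exists z.
Qed.

Lemma ideal_mulOF (I : set F) : ring_ideal I -> ideal_mul I (OF F) = I.
Proof.
move=> [I0 ID IM]; apply/seteqP; split.
  by apply: ideal_mul_ind => // x y Ix Oy; rewrite mulrC; exact: IM.
by move=> x Ix; rewrite -(mulr1 x); apply: ideal_mul_gen => //; exact: OF1.
Qed.

Lemma ideal_mul_principal (I : set F) f : ring_ideal I ->
  ideal_mul I [set f^-1 * x | x in OF F] = [set f^-1 * x | x in I].
Proof.
move=> [I0 ID IM]; apply/seteqP; split.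
  apply: ideal_mul_ind.
  - by exists 0; rewrite ?mulr0.
  - by move=> _ _ [x Ix <-] [y Iy <-]; exists (x + y); [exact: ID | rewrite mulrDr].
  - move=> x _ Ix [y Oy <-]; exists (y * x); [exact: IM | ring].
move=> _ [x Ix <-]; rewrite mulrC; apply: ideal_mul_gen => //.
by exists 1; rewrite ?mulr1 //; exact: OF1.
Qed.

(** Each inclusion multiplies an expansion of [1] by the given element: [1] taken in [J J^-1] gives
    that [I] lies in [f J], and [1] taken in [I J^-1 f^-1] gives the converse. *)
Lemma ideal_quotient_principal (I J : set F) f : f != 0 ->
    fractional_ideal I -> fractional_ideal J ->
    ideal_mul (ideal_mul I (ideal_inv J)) [set f^-1 * x | x in OF F] = OF F ->
  I = [set f * y | y in J].
Proof.
move=> f_neq0 I_frac J_frac IJf.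
have [I0 ID IM] := fractional_ring_ideal I_frac.
have [J0 JD JM] := fractional_ring_ideal J_frac.
apply/seteqP; split=> [x Ix|_ [y Jy <-]].
  exists (f^-1 * x); last by rewrite mulVKf.
  have := fractional_ideal_invertible J_frac.
  pose K : set F := [set t | J (t * (f^-1 * x))].
  rewrite -[f^-1 * x]mul1r -/(K 1); apply: (@ideal_mul_ind _ _ K) => [||y z Jy Jz].
  - by rewrite /K /= mul0r.
  - by move=> a b; rewrite /K /= mulrDl; exact: JD.
  rewrite /K /= -mulrA mulrC; apply: JM => //.
  rewrite -IJf (_ : z * _ = (x * z) * (f^-1 * 1)); last by ring.
  apply: ideal_mul_gen; first exact: ideal_mul_gen.
  by exists 1 => //; exact: OF1.
have := OF1; rewrite -IJf; pose K : set F := [set t | I (t * (f * y))].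
rewrite -[f * y]mul1r -/(K 1); apply: (@ideal_mul_ind _ _ K) => [||a _ IJa [b Ob <-]].
- by rewrite /K /= mul0r.
- by move=> a b; rewrite /K /= mulrDl; exact: ID.
rewrite /K /= (_ : a * (f^-1 * b) * (f * y) = b * (a * y)); last by field.
apply: (IM) => //; move: a IJa; apply: (@ideal_mul_ind _ _ [set a | I (a * y)]) => /=.
- by rewrite mul0r.
- by move=> a a'; rewrite mulrDl; exact: ID.
- by move=> x z Ix Jz; rewrite -mulrA mulrC; apply: IM => //; exact: Jz.
Qed.

(** As [m A] lies in [B], the finitely many representatives of [A] modulo [m] meet every coset.
    Positivity expresses finiteness here, an infinite family of cosets being counted as [0]. *)
Lemma finite_cosets (A B : set F) (m : nat) : (0 < m)%N -> A 0 ->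
    (forall x y, A x -> A y -> A (x - y)) ->
    (forall x y, B x -> B y -> B (x - y)) -> (forall x, A x -> B (x *+ m)) ->
  (0 < subgroup_index A B)%N.
Proof.
move=> m_gt0 A0 AB BB mA.
have [s [sA s_reps]] := subgroup_representatives m_gt0 A0 AB.
have B0 : B 0 by rewrite -(mul0rn _ m); exact: mA.
have BD x y : B x -> B y -> B (x + y).
  by move=> Bx By; rewrite -[y]opprK -[- y]sub0r; do 2!apply: (BB) => //.
have cosets_sub : cosets A B `<=` [set [set y + b | b in B] | y in [set` s]].
  move=> _ [x Ax <-]; have [y [z [sy Az ->]]] := s_reps x Ax.
  exists y => //; apply/seteqP; split=> _ [b Bb <-].
    exists (b - z *+ m); first by apply: BB => //; exact: mA.
    by rewrite addrACA subrr addr0.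
  by exists (z *+ m + b); [apply: BD => //; exact: mA | rewrite addrA].
have cosets_fin : finite_set (cosets A B).
  by apply: sub_finite_set cosets_sub _; apply: finite_image; exact: finite_seq.
rewrite /subgroup_index cardfs_gt0; apply/fset0Pn.
exists [set 0 + y | y in B]; rewrite in_fset_set //; apply/mem_set.
by exists 0.
Qed.

Lemma ideal_norm_gt0 (R : realType) (I : set F) :
  fractional_ideal I -> 0 < ideal_norm R I.
Proof.
move=> I_frac; have I_ideal := fractional_ring_ideal I_frac.
have [I0 ID IM] := I_ideal; have IB x y := @ring_idealB I x y I_ideal.
have capB x y : (OF F `&` I) x -> (OF F `&` I) y -> (OF F `&` I) (x - y).
  by move=> [Ox Ix] [Oy Iy]; split; [exact: OFB | exact: IB].
rewrite divr_gt0 // ltr0n.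
  have [m [m_gt0 Im]] := fractional_ideal_contains_nat I_frac.
  apply: (finite_cosets m_gt0) => //; [exact: OF0 | exact: OFB |].
  move=> x Ox; rewrite -mulr_natr; split; last exact: IM.
  by apply: OFM => //; exact: OF_nat.
have [m [m_gt0 mI]] := fractional_ideal_multiple I_frac.
apply: (finite_cosets m_gt0) => // x Ix; split; first exact: mI.
by rewrite -mulr_natl; apply: IM => //; exact: OF_nat.
Qed.

End Ideals.

(** * Counting embeddings: [r1 + 2 r2 = n] *)

Section PlaceCount.
Variables (R : realType) (F : fieldExtType rat) (P : infinite_places R F).
Local Notation "p ^F" := (map_poly (in_alg F) p) (at level 2, format "p ^F").
Local Notation "p ^Cx" := (map_poly (ratr : rat -> R[i]) p) (at level 2, format "p ^Cx").

Lemma separable_primitive_element : exists x : F, <<1; x>>%VS = {:F}%VS.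
Proof.
exists (separable_generator 1 {:F}); rewrite -eq_adjoin_separable_generator ?sub1v //.
apply/separableP => y _; apply: pcharf0_separable => p.
apply/negP; rewrite inE => /andP[p_prime]; rewrite natr_fieldExt_eq0.
by move=> /eqP p0; rewrite p0 in p_prime.
Qed.

Section Generator.
Variable x : F.
Hypothesis x_gen : <<1; x>>%VS = {:F}%VS.

Lemma generator_poly (y : F) : exists u : {poly rat}, u^F.[x] = y.
Proof.
have /polyOver1P[u def_u] := Fadjoin_polyOver 1 x y.
by exists u; rewrite -def_u Fadjoin_poly_eq // x_gen memvf.
Qed.

Lemma rmorph_horner_rat (phi : {rmorphism F -> R[i]}) (u : {poly rat}) :
  phi u^F.[x] = u^Cx.[phi x].
Proof.
rewrite -horner_map /= -map_poly_comp; congr (_.[_]).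
by apply: eq_map_poly => a /=; rewrite rmorphZ_num rmorph1 mulr1.
Qed.

Lemma eq_generator_rmorph (phi psi : {rmorphism F -> R[i]}) :
  phi x = psi x -> phi =1 psi.
Proof. by move=> e y; have [u <-] := generator_poly y; rewrite !rmorph_horner_rat e. Qed.

(** Embeddings correspond to the complex roots of the minimal polynomial of the generator, which are
    distinct by separability and hence as many as the degree. *)
Lemma minPoly_complex_roots : exists r : seq R[i],
  [/\ uniq r, size r = \dim {:F}, forall phi : {rmorphism F -> R[i]}, phi x \in r
    & forall z, z \in r -> exists phi : {rmorphism F -> R[i]}, phi x = z].
Proof.
have /polyOver1P[q def_q] := minPolyOver 1 x.
have [r def_r] := closed_field_poly_normal q^Cx.
have q_root0 : q^F.[x] = 0 by rewrite -def_q minPolyxx.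
have lead_neq0 : lead_coef q^Cx != 0.
  rewrite lead_coef_eq0 map_poly_eq0; apply/negP => /eqP q0.
  by have /monic_neq0 := monic_minPoly 1 x; rewrite def_q q0 rmorph0 eqxx.
have mem_r z : (z \in r) = root q^Cx z.
  by rewrite def_r rootZ // root_prod_XsubC.
have size_r : size r = \dim {:F}.
  have := dim_Fadjoin 1 x; rewrite x_gen dimv1 muln1 => ->.
  apply: succn_inj; rewrite -(size_minPoly 1 x) def_q size_map_poly.
  rewrite -(size_map_poly (ratr : rat -> R[i])).
  by rewrite def_r size_scale // size_prod_XsubC.
exists r; split=> //.
- rewrite -separable_prod_XsubC -(eqp_separable (eqp_scale _ lead_neq0)) -def_r.
  rewrite separable_map -(separable_map (in_alg F)) -def_q.
  have := pcharf0_separable 1 _ x; apply => p.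
  apply/negP; rewrite inE => /andP[p_prime]; rewrite natr_fieldExt_eq0.
  by move=> /eqP p0; rewrite p0 in p_prime.
- by move=> phi; rewrite mem_r rootE -rmorph_horner_rat q_root0 rmorph0.
move=> z; rewrite mem_r => qz0.
(* Well defined because the minimal polynomial of [x] vanishes at [z]. *)
have vanish (u : {poly rat}) : u^F.[x] = 0 -> u^Cx.[z] = 0.
  move=> /eqP ux0; have q_dvd_u : q %| u.
    rewrite -(dvdp_map (in_alg F)) -def_q; apply: minPoly_dvdp => //.
    by apply/polyOver1P; exists u.
  by apply/rootP; apply: root_dvdp qz0; rewrite dvdp_map.
have [rep repK] := choice generator_poly.
pose phi y := (rep y)^Cx.[z].
have phiP y u : u^F.[x] = y -> phi y = u^Cx.[z].
  move=> def_y; apply/eqP; rewrite -subr_eq0 -hornerN -hornerD -rmorphB /=.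
  by apply/eqP/vanish; rewrite rmorphB hornerD hornerN repK def_y subrr.
have phiB : zmod_morphism phi.
  move=> y1 y2; rewrite (@phiP _ (rep y1 - rep y2)) ?rmorphB ?hornerD ?hornerN //.
  by rewrite !repK.
have phiM : monoid_morphism phi.
  split; first by rewrite (@phiP _ 1) ?rmorph1 ?hornerC.
  move=> y1 y2; rewrite (@phiP _ (rep y1 * rep y2)) ?rmorphM ?hornerM //.
  by rewrite !repK.
pose phiA := GRing.isZmodMorphism.Build _ _ phi phiB.
pose phiR := GRing.isMonoidMorphism.Build _ _ phi phiM.
pose psi : {rmorphism F -> R[i]} := HB.pack phi phiA phiR.
exists psi; rewrite /= (@phiP _ 'X) ?map_polyX ?hornerX //.
Qed.

End Generator.

Definition rplaceC (i : 'I_(r1 P)) : {rmorphism F -> R[i]} :=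
  (real_complex R \o rplace P i).

Definition cplace_conj (j : 'I_(r2 P)) : {rmorphism F -> R[i]} :=
  (conjc \o cplace P j).

(** The real embeddings, the chosen nonreal ones and their conjugates send a generator to each of
    these roots exactly once. *)
Lemma place_count : (r1 P + 2 * r2 P)%N = field_degree F.
Proof.
have [x x_gen] := separable_primitive_element.
rewrite /field_degree; have [r [r_uniq <- r_in r_onto]] := minPoly_complex_roots x_gen.
pose e (k : 'I_(r1 P) + ('I_(r2 P) + 'I_(r2 P))) : {rmorphism F -> R[i]} :=
  match k with inl i => rplaceC i | inr (inl j) => cplace P j
             | inr (inr j) => cplace_conj j end.
have Im_conj (z : R[i]) : complex.Im (conjc z) = - complex.Im z by case: z.
have nonreal j (h : F -> R[i]) : (forall y, complex.Im (h y) = 0) ->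
    cplace P j =1 h -> False.
  by move=> h0 e_h; have [y] := @cplace_nonreal _ _ P j; rewrite e_h h0 eqxx.
have conj_fix j : cplace P j =1 cplace_conj j -> False.
  move=> ej; have [y /eqP] := @cplace_nonreal _ _ P j; apply.
  have := congr1 (@complex.Im R) (ej y); rewrite /= Im_conj; lra.
have e_inj : injective (fun k => e k x).
  move=> k l /(eq_generator_rmorph x_gen).
  case: k l => [i|[i|i]] [j|[j|j]] /= eq_kl.
  - congr inl; apply: (@rplace_inj _ _ P) => y.
    by have := congr1 (@complex.Re R) (eq_kl y).
  - by case: (nonreal j (rplaceC i)) => // y; exact/esym/eq_kl.
  - case: (nonreal j (rplaceC i)) => // y.
    have ey : conjc (cplace P j y) = (rplace P i y)%:C%C by exact/esym/eq_kl.
    by rewrite -[LHS]conjcK ey /= oppr0.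
  - by case: (nonreal i (rplaceC j)).
  - by congr (inr (inl _)); apply: (@cplace_inj _ _ P); left.
  - have eq_ij : i = j by apply: (@cplace_inj _ _ P); right.
    by case: (conj_fix j) => y; rewrite -{1}eq_ij; exact: eq_kl.
  - case: (nonreal i (rplaceC j)) => // y.
    have ey : conjc (cplace P i y) = (rplace P j y)%:C%C by exact: eq_kl.
    by rewrite -[LHS]conjcK ey /= oppr0.
  - have eq_ij : j = i by apply: (@cplace_inj _ _ P); right => y; exact/esym/eq_kl.
    by case: (conj_fix i) => y; rewrite -{1}eq_ij; exact/esym/eq_kl.
  - congr (inr (inr _)); apply: (@cplace_inj _ _ P); left => y.
    by rewrite -[LHS]conjcK -[RHS]conjcK; congr conjc; apply: eq_kl.
have := perm_size (uniq_perm _ r_uniq _ : perm_eq (codom (fun k => e k x)) r).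
rewrite size_codom !card_sum !card_ord addnn -mul2n; apply.
  by rewrite map_inj_uniq ?enum_uniq.
move=> z; apply/codomP/idP => [[k ->]|]; first exact: r_in.
move=> /r_onto[phi <-]; have [[i phiE]|[j [phiE|phiE]]] := @places_exhaustive _ _ P phi.
- by exists (inl i); rewrite phiE.
- by exists (inr (inl j)); rewrite phiE.
- by exists (inr (inr j)); rewrite phiE.
Qed.

End PlaceCount.

(** * Rigidity of scalings between strongly reduced ideals *)

Section ReducedScaling.
Variables (R : realType) (F : fieldExtType rat) (P : infinite_places R F).
Implicit Types (I J : set F) (f g : F) (s : place P) (C t eps : R).

Definition place_embed s : {rmorphism F -> R[i]} :=
  match s with inl i => rplaceC i | inr j => cplace P j end.

Lemma place_val_embed f s : place_val (FR_embed P f) s = place_embed s f.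
Proof. by case: s => i /=; rewrite ffunE. Qed.

Definition place_sum (h : place P -> R) : R := \sum_s (pdeg s)%:R * h s.

Lemma place_sum_add h1 h2 :
  place_sum (fun s => h1 s + h2 s) = place_sum h1 + place_sum h2.
Proof. by rewrite -big_split; apply: eq_bigr => s _; rewrite mulrDr. Qed.

Lemma place_sum_scale a h : place_sum (fun s => a * h s) = a * place_sum h.
Proof. by rewrite mulr_sumr; apply: eq_bigr => s _; rewrite mulrCA. Qed.

Lemma eq_place_sum h1 h2 : h1 =1 h2 -> place_sum h1 = place_sum h2.
Proof. by move=> e; apply: eq_bigr => s _; rewrite e. Qed.

Lemma pdeg_gt0 s : (0 : R) < (pdeg s)%:R.
Proof. by case: s => i; rewrite ltr0n. Qed.

Lemma place_sum_const a : place_sum (fun=> a) = (field_degree F)%:R * a.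
Proof.
rewrite /place_sum -mulr_suml -(place_count P) big_sumType /=; congr (_ * _).
by rewrite !sumr_const !card_ord natrD natrM mulr_natr.
Qed.

Lemma field_degree_gt0 : (0 < field_degree F)%N.
Proof. exact: adim_gt0. Qed.

Lemma place_exists : exists s0 : place P, True.
Proof.
apply: contrapT => no_s; have := place_sum_const 1; rewrite mulr1 /place_sum.
rewrite big1 => [/esym/eqP|s _]; last by case: no_s; exists s.
by rewrite pnatr_eq0 -[_ == _]negbK -lt0n field_degree_gt0.
Qed.

Definition sqnorm g := place_sum (fun s => cabs (place_embed s g) ^+ 2).

Lemma FR_norm_embed g : FR_norm (FR_embed P g) ^+ 2 = sqnorm g.
Proof.
rewrite /FR_norm sqr_sqrtr; last first.
  apply: addr_ge0; first by apply: sumr_ge0 => i _; rewrite sqr_ge0.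
  by rewrite mulr_ge0 //; apply: sumr_ge0 => i _; rewrite sqr_ge0.
rewrite /sqnorm /place_sum big_sumType /=; congr (_ + _).
  apply: eq_bigr => i _; rewrite ffunE mul1r; congr (_ ^+ 2).
  exact/esym/cabsC.
by rewrite mulr_sumr; apply: eq_bigr => j _; rewrite ffunE.
Qed.

Lemma sqnorm1 : sqnorm 1 = (field_degree F)%:R.
Proof.
rewrite -[RHS]mulr1 -place_sum_const; apply: eq_place_sum => s.
by rewrite rmorph1 cabs1 expr1n.
Qed.

Lemma strongly_reduced_sqnorm_ge C I g : 1 <= C ->
    strongly_reduced_ideal P C I -> I g -> g != 0 ->
  (field_degree F)%:R / C ^+ 2 <= sqnorm g.
Proof.
move=> C_ge1 [_ _ _ I_red] Ig g_neq0.
have C_gt0 : 0 < C by lra.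
rewrite ler_pdivrMr ?exprn_gt0 // -sqnorm1 -!FR_norm_embed mulrC -exprMn.
rewrite ler_sqr ?nnegrE ?mulr_ge0 ?sqrtr_ge0 //; first exact: I_red.
exact: ltW.
Qed.

(** The coefficients are the Gram matrix of [f] and [1]: the middle one is the trace of [f] and the
    last one is the squared length of [1]. *)
Lemma sqnorm_form f (x y : int) :
  sqnorm (x%:~R * f + y%:~R)
  = binary_form (sqnorm f) (place_sum (fun s => complex.Re (place_embed s f)))
      (field_degree F)%:R x%:~R y%:~R.
Proof.
rewrite /binary_form.
have -> : (field_degree F)%:R * y%:~R ^+ 2 = place_sum (fun=> y%:~R ^+ 2).
  by rewrite place_sum_const.
rewrite [sqnorm f * _]mulrC (_ : 2 * _ * _ * _ = (2 * x%:~R * y%:~R) *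
  place_sum (fun s => complex.Re (place_embed s f))); last by ring.
rewrite -!place_sum_scale -!place_sum_add; apply: eq_place_sum => s.
rewrite rmorphD rmorphM !rmorph_int !cabs_sqr.
have intrC (z : int) : z%:~R = (z%:~R : R)%:C%C :> R[i] by rewrite rmorph_int.
by rewrite !intrC; case: (place_embed s f) => a b /=; ring.
Qed.

(* The lattice [Z f + Z] scaled by [(t, 1)] has small determinant since [t f] is
   close to [1]; Hermite bounds its determinant from below. *)
Lemma irrational_scaling_lt1 C eps t I f :
    1 <= C -> 4 * C ^+ 4 * eps ^+ 2 = 3 -> 0 <= eps -> 0 < t ->
    strongly_reduced_ideal P C I -> I f ->
    (forall x y : int, (x != 0) || (y != 0) -> x%:~R * f + y%:~R != 0) ->
    (forall s, cabs (t%:C%C * place_embed s f - 1) < eps) ->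
  t < 1.
Proof.
move=> C_ge1 epsE eps_ge0 t_gt0 I_red If f_irr f_close.
have [I_frac I1 _ _] := I_red; have [_ ID IM] := fractional_ring_ideal I_frac.
have C_gt0 : 0 < C by lra.
set n : R := (field_degree F)%:R; have n_gt0 : 0 < n by rewrite ltr0n field_degree_gt0.
set B := place_sum (fun s => complex.Re (place_embed s f)).
have mu_gt0 : 0 < n / C ^+ 2 by rewrite divr_gt0 ?exprn_gt0.
have herm : 3 / 4 * (n / C ^+ 2) ^+ 2 <= sqnorm f * n - B ^+ 2.
  apply: hermite_bound => // x y xy; rewrite -sqnorm_form.
  apply: (strongly_reduced_sqnorm_ge C_ge1 I_red); last exact: f_irr.
  apply: ID; first by apply: IM => //; exact: OF_int.
  by rewrite -[_%:~R]mulr1; apply: IM => //; exact: OF_int.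
have eps_sqr : eps ^+ 2 = 3 / 4 / C ^+ 4.
  by rewrite -epsE; field; rewrite gt_eqF.
(* The value of [eps] is the one for which Hermite's bound equals [n^2 eps^2]. *)
have muE : 3 / 4 * (n / C ^+ 2) ^+ 2 = n ^+ 2 * eps ^+ 2.
  by rewrite eps_sqr; field; rewrite gt_eqF.
have eps_gt0 : 0 < eps ^+ 2 by rewrite eps_sqr !divr_gt0 ?exprn_gt0.
pose W := place_sum (fun s => cabs (t%:C%C * place_embed s f - 1) ^+ 2).
have W_lt : W < n * eps ^+ 2.
  rewrite -place_sum_const; have [s0 _] := place_exists.
  apply: ltr_sum; first by apply/hasP; exists s0; rewrite ?mem_index_enum.
  move=> s _; rewrite ltr_pM2l ?pdeg_gt0 //.
  by rewrite ltr_sqr ?nnegrE ?cabs_ge0 ?f_close.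
have WE : W = t ^+ 2 * sqnorm f - 2 * t * B + n.
  rewrite -mulNr -[n]mulr1 -place_sum_const -!place_sum_scale -!place_sum_add.
  apply: eq_place_sum => s; rewrite !cabs_sqr.
  by case: (place_embed s f) => a b /=; ring.
rewrite -(ltr_pXn2r (n := 2)) ?nnegrE ?ler01 ?ltW // expr1n.
(* [n W] exceeds [t^2] times the Gram determinant by exactly [(n - t B)^2]. *)
have sq := sqr_ge0 (n - t * B).
have nW : n * W < n * (n * eps ^+ 2) by rewrite ltr_pM2l.
have detW : t ^+ 2 * (sqnorm f * n - B ^+ 2) <= n * W.
  by rewrite WE; move: sq; rewrite !expr2; lra.
have n2_gt0 : 0 < n ^+ 2 * eps ^+ 2 by rewrite mulr_gt0 // exprn_gt0.
rewrite -(ltr_pM2r n2_gt0) mul1r.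
apply: (@le_lt_trans _ _ (t ^+ 2 * (sqnorm f * n - B ^+ 2))).
  by apply: ler_wpM2l; [exact: sqr_ge0 | rewrite -muE].
by apply: le_lt_trans detW _; rewrite expr2 -mulrA.
Qed.

(** Here [f = - y / x] in lowest terms; from [u x + v y = 1] comes [1 / x = u - v f], an element of
    [I], and primitivity of [1] leaves only [x = 1] or [x = -1]. *)
Lemma primitive_rational_coefficient I f (x y : int) : ring_ideal I -> I 1 ->
    (forall d, (2 <= d)%N -> ~ I d%:R^-1) -> I f ->
    coprimez x y -> x%:~R * f + y%:~R = 0 ->
  `|x|%N = 1%N.
Proof.
move=> [_ ID IM] I1 I_prim If /coprimezP[[u v] /= uv1] xfy.
have x_neq0 : x != 0.
  apply/eqP => x0; move: xfy uv1; rewrite x0 mul0r add0r mulr0 add0r.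
  by move=> /eqP; rewrite intr_fieldExt_eq0 => /eqP->; rewrite mulr0.
have xF_neq0 : (x%:~R : F) != 0 by rewrite intr_fieldExt_eq0.
have x_inv : I x%:~R^-1.
  have -> : (x%:~R : F)^-1 = u%:~R * 1 + (- v)%:~R * f.
    have yE : y%:~R = - (x%:~R * f) by apply/eqP; rewrite -addr_eq0 addrC xfy.
    have E : (u * x + v * y)%:~R = 1 :> F by rewrite uv1.
    rewrite intrD !intrM yE in E.
    by apply: (mulfI xF_neq0); rewrite divff // -[LHS]E mulrNz; ring.
  by apply: ID; apply: IM => //; exact: OF_int.
have x_abs : I (`|x|%N%:R)^-1.
  have -> : ((`|x|%N%:R : F))^-1 = (Num.sg x)%:~R * x%:~R^-1.
    rewrite pmulrn abszE normrEsg intrM invfM; congr (_ * _).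
    by have [] := sgrP x; rewrite ?invr1 ?invrN1 // => x0; rewrite x0 eqxx in x_neq0.
  by apply: IM => //; exact: OF_int.
case: `|x|%N (absz_eq0 x) x_abs => [|[|d]] // [].
  by rewrite (negPf x_neq0).
by move=> _ /I_prim; case.
Qed.

Lemma strongly_reduced_scaling C eps t I J f :
    1 <= C -> 4 * C ^+ 4 * eps ^+ 2 = 3 -> 0 <= eps -> 0 < t -> f != 0 ->
    strongly_reduced_ideal P C I -> strongly_reduced_ideal P C J ->
    I = [set f * y | y in J] ->
    (forall s, cabs (t%:C%C * place_embed s f - 1) < eps /\
      cabs ((t%:C%C * place_embed s f)^-1 - 1) < eps) ->
  f = 1.
Proof.
move=> C_ge1 epsE eps_ge0 t_gt0 f_neq0 I_red J_red def_I f_close.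
have [I_frac I1 I_prim _] := I_red; have [J_frac J1 J_prim _] := J_red.
have If : I f by rewrite def_I; exists 1; rewrite ?mulr1.
have Jf : J f^-1.
  by move: I1; rewrite def_I => -[y Jy fy1]; rewrite -[f^-1]mulr1 -fy1 mulKf.
have [f_irr|] := pselect (forall x y : int,
    (x != 0) || (y != 0) -> x%:~R * f + y%:~R != 0).
  have t_lt1 : t < 1.
    apply: (irrational_scaling_lt1 C_ge1 epsE eps_ge0 t_gt0 I_red If f_irr).
    by move=> s; have [] := f_close s.
  have : t^-1 < 1.
    have ti_gt0 : 0 < t^-1 by rewrite invr_gt0.
    apply: (irrational_scaling_lt1 C_ge1 epsE eps_ge0 ti_gt0 J_red Jf).
      move=> x y xy; have := f_irr y x; rewrite orbC => /(_ xy).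
      apply: contraNneq => xfy0.
      have -> : y%:~R * f + x%:~R = (x%:~R / f + y%:~R) * f.
        by rewrite mulrDl mulfVK // addrC.
      by rewrite xfy0 mul0r.
    move=> s; have [_] := f_close s.
    by rewrite invfM -!fmorphV.
  by rewrite invf_lt1 // => t_gt1; exfalso; lra.
move=> /existsNP[x0 /existsNP[y0 /not_implyP[xy0 /negP/negPn/eqP xfy0]]].
(* Dividing the integer relation by the gcd makes its coefficients coprime. *)
have [x [y [xy xfy]]] : exists x y : int, coprimez x y /\ x%:~R * f + y%:~R = 0.
  have g_neq0 : gcdz x0 y0 != 0 by rewrite gcdz_eq0 negb_and.
  exists (x0 %/ gcdz x0 y0)%Z, (y0 %/ gcdz x0 y0)%Z; split.
    have := mulz_gcdl (x0 %/ gcdz x0 y0)%Z (y0 %/ gcdz x0 y0)%Z (gcdz x0 y0).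
    rewrite !divzK ?dvdz_gcdl ?dvdz_gcdr // gez0_abs // => gcd_mul.
    by apply/eqP/(mulIf g_neq0); rewrite gcd_mul mul1r.
  have gF_neq0 : ((gcdz x0 y0)%:~R : F) != 0 by rewrite intr_fieldExt_eq0.
  apply: (mulIf gF_neq0); rewrite mul0r -xfy0 mulrDl mulrAC -!intrM.
  by rewrite !divzK ?dvdz_gcdl ?dvdz_gcdr.
have x_abs := primitive_rational_coefficient (fractional_ring_ideal I_frac) I1 I_prim
  If xy xfy.
have yx : coprimez y x by rewrite coprimez_sym.
have yfx : y%:~R * f^-1 + x%:~R = 0.
  by apply: (mulIf f_neq0); rewrite mul0r mulrDl mulfVK // addrC.
have y_abs := primitive_rational_coefficient (fractional_ring_ideal J_frac) J1 J_prim
  Jf yx yfx.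
have abs1 (z : int) : `|z|%N = 1%N -> z = 1 \/ z = -1.
  by case: z => [[|[|n]]|[|n]] //; [left | right].
have [//|f_N1] : f = 1 \/ f = -1.
  have [] := abs1 _ x_abs; have [] := abs1 _ y_abs => yE xE;
    move: xfy; rewrite xE yE ?mulrNz !mulr1z ?mulN1r ?mul1r => /eqP;
    rewrite ?addr_eq0 ?subr_eq0 ?eqr_opp ?eqr_oppLR ?opprK => /eqP ->; by [left | right].
(* For [f = -1] closeness reads [t + 1 < eps], whereas [4 C^4 eps^2 = 3] and [C >= 1] give
   [eps <= 1]. *)
have [s _] := place_exists; have [+ _] := f_close s.
rewrite f_N1 rmorphN rmorph1 mulrN1 cabsE /= oppr0 addr0 expr0n addr0 sqrtr_sqr.
rewrite ltr0_norm; last by lra.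
have : eps ^+ 2 <= 1.
  have C4 : 1 <= C ^+ 4 by rewrite exprn_ege1.
  have := ler_peMl (sqr_ge0 eps) C4; lra.
rewrite -[X in _ <= X](expr1n _ 2) ler_sqr ?nnegrE ?ler01 // => eps_le1 eps_gt; exfalso; lra.
Qed.

End ReducedScaling.

(** * Oriented divisors, their degrees and their classes *)

Section Divisors.
Variables (R : realType) (F : fieldExtType rat) (P : infinite_places R F).
Implicit Types (I J : set F) (f e : F) (s : place P) (u v w : FR P) (C c : R).

Lemma place_valM u w s : place_val (u * w) s = place_val u s * place_val w s.
Proof. by case: s => i /=; rewrite ffunE // rmorphM. Qed.

Lemma place_val_const c s : place_val (FR_const P c) s = c%:C%C.
Proof. by case: s => i /=; rewrite ffunE. Qed.

Lemma place_valV u s : place_val (FR_inv u) s = (place_val u s)^-1.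
Proof. by case: s => i /=; rewrite ffunE // fmorphV. Qed.

Lemma place_val1 s : place_val (1 : FR P) s = 1.
Proof. by case: s => i /=; rewrite ffunE. Qed.

Lemma place_val_inj u w : place_val u =1 place_val w -> u = w.
Proof.
case: u w => [u1 u2] [w1 w2] e; congr pair; apply/ffunP => i.
  by have /(congr1 (@complex.Re R)) := e (inl i).
exact: (e (inr i)).
Qed.

Lemma FR_unitP u : FR_unit u <-> forall s, place_val u s != 0.
Proof.
split=> [[w uw1] s|u_neq0].
  have := place_val1 s; rewrite -uw1 place_valM => e.
  by apply: contra_eq_neq e => ->; rewrite mul0r eq_sym oner_eq0.
exists (FR_inv u); apply: place_val_inj => s.
by rewrite place_valM place_valV place_val1 divff.
Qed.

Definition ideal_scale I : R := powR (ideal_norm R I) (- (field_degree F)%:R^-1).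

Lemma ideal_scale_gt0 I : fractional_ideal I -> 0 < ideal_scale I.
Proof. by move=> I_frac; rewrite powR_gt0 // ideal_norm_gt0. Qed.

Lemma deltaE C : 1 <= C -> expR (delta C) - 1 = Num.sqrt 3 / (2 * C ^+ 2).
Proof.
move=> C_ge1; have C2_gt0 : 0 < 2 * C ^+ 2 by rewrite mulr_gt0 // exprn_gt0; lra.
rewrite /delta lnK; first by rewrite addrC addKr.
by rewrite posrE ltr_wpDr // divr_ge0 ?sqrtr_ge0 // ltW.
Qed.

(** The relation that [strongly_reduced_scaling] asks of [eps = exp delta - 1]. *)
Lemma delta_sqr C : 1 <= C -> 4 * C ^+ 4 * (expR (delta C) - 1) ^+ 2 = 3.
Proof.
move=> C_ge1; rewrite deltaE // expr_div_n sqr_sqrtr //; field.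
by rewrite gt_eqF; lra.
Qed.

Lemma delta_ge0 C : 1 <= C -> 0 <= expR (delta C) - 1.
Proof.
move=> C_ge1; rewrite deltaE // divr_ge0 ?sqrtr_ge0 //.
by rewrite mulr_ge0 // sqr_ge0.
Qed.

Lemma strongly_reduced_ideal_eq C c I J f : 1 <= C -> 0 < c -> f != 0 ->
    strongly_reduced_ideal P C I -> strongly_reduced_ideal P C J ->
    I = [set f * y | y in J] ->
    (forall s, cabs (Log (c%:C%C * place_embed s f)) < delta C) ->
  I = J.
Proof.
move=> C_ge1 c_gt0 f_neq0 I_red J_red def_I log_lt.
have f1 : f = 1.
  apply: (strongly_reduced_scaling C_ge1 (delta_sqr C_ge1) (delta_ge0 C_ge1)
    c_gt0 f_neq0 I_red J_red def_I) => s.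
  apply: cabs_sub1_lt (log_lt s).
  by rewrite mulf_neq0 ?fmorph_eq0 // gt_eqF.
rewrite def_I f1; apply/seteqP; split=> [_ [y Jy <-]|y Jy]; first by rewrite mul1r.
by exists y; rewrite ?mul1r.
Qed.

(** Allows the unit coming from [Pic_norm] to be absorbed into [f]. *)
Lemma ideal_unit_mul J e f : fractional_ideal J -> OF F e -> OF F e^-1 -> e != 0 ->
  [set f * y | y in J] = [set (f * e) * y | y in J].
Proof.
move=> J_frac Oe Oei e_neq0; have [_ _ JM] := fractional_ring_ideal J_frac.
apply/seteqP; split=> _ [y Jy <-].
  by exists (e^-1 * y); [exact: JM | rewrite mulrA mulfK].
by exists (e * y); [exact: JM | rewrite mulrA].
Qed.

(** Divisors of ideals have constant coordinates, so [v] is the embedding of [f] up to one real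
    factor, the [t] of the scaling argument. *)
Lemma odiv_sub_of_ideal I J f v :
    odiv_add (odiv_sub (odiv_of_ideal P I) (odiv_of_ideal P J)) (principal P f)
      = (OF F, v) ->
  ideal_mul (ideal_mul I (ideal_inv J)) [set f^-1 * x | x in OF F] = OF F
  /\ forall s, place_val v s
       = (ideal_scale I / ideal_scale J)%:C%C * place_embed s f.
Proof.
move=> [e1 e2]; split=> // s; rewrite -e2 2!place_valM place_valV.
by rewrite 2!place_val_const place_val_embed rmorphM fmorphV.
Qed.

Lemma positive_units1 : positive_units P 1.
Proof.
split; rewrite ?invr1; try exact: OF1.
by split=> [|i]; rewrite ?oner_eq0 // rmorph1.
Qed.

(** Some unit has its sum below [d^2] once the infimum is, and each term is at most the sum because
    degrees are at least [1]. *)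
Lemma Pic_norm_lt v d : Pic_norm v < d ->
  exists2 e, positive_units P e
    & forall s, cabs (Log (place_val v s * place_embed s e)) < d.
Proof.
move=> Pic_lt; pose S := [set \sum_(s : place P) (pdeg s)%:R *
  cabs (Log (place_val v s * place_val (FR_embed P e) s)) ^+ 2
  | e in positive_units P].
have S0 : S !=set0.
  by eexists; exists 1; first exact: positive_units1.
have d_gt0 : 0 < d by apply: le_lt_trans Pic_lt; exact: sqrtr_ge0.
have inf_lt_d : inf S < d ^+ 2.
  rewrite -ltr_sqrt ?exprn_gt0 // sqrtr_sqr gtr0_norm //.
have [_ [e e_pos <-] sum_lt] := inf_lt S0 inf_lt_d.
exists e => // s; rewrite -ltr_sqr ?nnegrE ?cabs_ge0 ?(ltW d_gt0) //.
apply: le_lt_trans sum_lt; rewrite (bigD1 s) //= place_val_embed.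
rewrite -[leLHS]addr0; apply: lerD.
  by rewrite ler_peMl ?sqr_ge0 //; case: (s) => i; rewrite ler1n.
by apply: sumr_ge0 => t _; rewrite mulr_ge0 ?sqr_ge0 ?ler0n.
Qed.

(** The unit [e] unites both halves of (i): [e = 1] for a bound on [v] itself, a nearly minimal [e]
    for a bound on [Pic_norm]. The scaling argument is applied to [f * e]. *)
Lemma Sred_eq C I J f v : 1 <= C -> strongly_reduced_ideal P C I ->
    strongly_reduced_ideal P C J -> f != 0 ->
    odiv_add (odiv_sub (odiv_of_ideal P I) (odiv_of_ideal P J)) (principal P f)
      = (OF F, v) ->
    (exists2 e, positive_units P e
      & forall s, cabs (Log (place_val v s * place_embed s e)) < delta C) ->
  I = J.
Proof.
move=> C_ge1 I_red J_red f_neq0 /odiv_sub_of_ideal[IJf vE].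
move=> [e [Oe Oei [e_neq0 _]] log_lt].
have [[I_frac _ _ _] [J_frac _ _ _]] := (I_red, J_red).
have c_gt0 : 0 < ideal_scale I / ideal_scale J by rewrite divr_gt0 ?ideal_scale_gt0.
have fe_neq0 : f * e != 0 by rewrite mulf_neq0.
apply: (strongly_reduced_ideal_eq C_ge1 c_gt0 fe_neq0) => // [|s].
  rewrite -ideal_unit_mul //.
  exact: ideal_quotient_principal.
by rewrite rmorphM mulrA -vE.
Qed.

Lemma odiv_add_trivial I v : fractional_ideal I ->
  odiv_add (odiv_of_ideal P I) (OF F, v) = (I, FR_const P (ideal_scale I) * v).
Proof.
move=> I_frac; rewrite /odiv_add /= ideal_mulOF //.
exact: fractional_ring_ideal.
Qed.

Lemma FR_conn_neq0 v s : FR_conn v -> place_val v s != 0.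
Proof.
by move=> [v1 v2]; case: s => i /=; rewrite ?fmorph_eq0 ?v2 // gt_eqF ?v1.
Qed.

Lemma FR_conn_log_N v : FR_conn v ->
  place_sum (fun s => ln (cabs (place_val v s))) = ln (FR_N v).
Proof.
move=> [v1 v2]; apply: expR_inj.
have N_gt0 : 0 < FR_N v.
  apply: mulr_gt0; first by apply: prodr_gt0 => i _; exact: v1.
  by apply: prodr_gt0 => j _; rewrite exprn_gt0 // cabs_gt0.
rewrite lnK ?posrE // /place_sum big_sumType expRD !expR_sum; congr (_ * _).
  apply: eq_bigr => i _; have vi : cabs (v.1 i)%:C%C = v.1 i by rewrite cabsC gtr0_norm.
  by rewrite [pdeg _]/= mul1r [cabs _]vi lnK ?posrE.
by apply: eq_bigr => j _; rewrite [pdeg _]/= expRM_natl lnK ?posrE ?cabs_gt0 //; exact: v2.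
Qed.

(** The exponent [-1/n], summed over places of total degree [n], cancels [log N(I)], and [N(v) = 1]
    removes the rest. *)
Lemma odiv_of_ideal_deg0 I v : fractional_ideal I -> FR_conn0 v ->
  oDiv0 (odiv_add (odiv_of_ideal P I) (OF F, v)).
Proof.
move=> I_frac [v_conn vN1]; rewrite odiv_add_trivial //.
have c_gt0 := ideal_scale_gt0 I_frac.
have cC_neq0 : (ideal_scale I)%:C%C != 0 :> R[i] by rewrite fmorph_eq0 gt_eqF.
split.
  split=> //=; apply/FR_unitP => s; rewrite place_valM place_val_const.
  by rewrite mulf_neq0 ?FR_conn_neq0.
have n_neq0 : ((field_degree F)%:R : R) != 0.
  by rewrite pnatr_eq0 -lt0n field_degree_gt0.
rewrite /odiv_deg /= -/(place_sum (fun s => ln (cabs (place_val _ s)))).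
rewrite (@eq_place_sum _ _ _ _ (fun s => ln (ideal_scale I) + ln (cabs (place_val v s)))).
  rewrite place_sum_add place_sum_const FR_conn_log_N // vN1 ln1 addr0.
  by rewrite ln_powR; field.
move=> s; rewrite place_valM place_val_const cabsM cabsC gtr0_norm //.
by rewrite lnM ?posrE // cabs_gt0 // FR_conn_neq0.
Qed.

(** Turns an equality of classes into membership of one divisor in the class of the other, which
    produces the element [f]. *)
Lemma odiv_class_refl (D : odivisor P) : ring_ideal D.1 -> odiv_class P D D.
Proof.
case: D => I u /= I_ideal; exists 1; first exact: oner_neq0.
rewrite /odiv_add /= ideal_mul_principal //; congr pair.
  apply/seteqP; split=> [_ [x Ix <-]|x Ix]; first by rewrite invr1 mul1r.
  by exists x; rewrite ?invr1 ?mul1r.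
apply: place_val_inj => s.
by rewrite place_valM place_val_embed rmorph1 mulr1.
Qed.

Lemma odiv_class_inj C I J v w : 1 <= C -> strongly_reduced_ideal P C I ->
    strongly_reduced_ideal P C J -> FR_conn v -> FR_conn w ->
    (forall s, cabs (Log (place_val v s)) < 2^-1 * delta C) ->
    (forall s, cabs (Log (place_val w s)) < 2^-1 * delta C) ->
    odiv_class P (I, FR_const P (ideal_scale I) * v)
      = odiv_class P (J, FR_const P (ideal_scale J) * w) ->
  (I, FR_const P (ideal_scale I) * v) = (J, FR_const P (ideal_scale J) * w).
Proof.
move=> C_ge1 I_red J_red v_conn w_conn v_lt w_lt eq_class.
have [[I_frac _ _ _] [J_frac _ _ _]] := (I_red, J_red).
have cI_gt0 := ideal_scale_gt0 I_frac; have cJ_gt0 := ideal_scale_gt0 J_frac.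
have := odiv_class_refl (D := (J, FR_const P (ideal_scale J) * w))
  (fractional_ring_ideal J_frac).
rewrite -eq_class => -[f f_neq0 eD].
have ew : FR_const P (ideal_scale I) * v * FR_embed P f = FR_const P (ideal_scale J) * w.
  exact: (congr1 snd eD).
have /= eJ := congr1 fst eD.
rewrite ideal_mul_principal in eJ; last exact: fractional_ring_ideal.
have def_I : I = [set f * y | y in J].
  rewrite -eJ; apply/seteqP; split=> [x Ix|_ [_ [x Ix <-] <-]].
    by exists (f^-1 * x); [exists x | rewrite mulVKf].
  by rewrite mulVKf.
have c_gt0 : 0 < ideal_scale I / ideal_scale J by rewrite divr_gt0.
(* The scaled embedding of [f] is a quotient of two elements whose logarithms are below half of
   [delta], so it and its inverse are within [exp delta - 1] of [1]. *)
have ratio s : (ideal_scale I / ideal_scale J)%:C%C * place_embed s f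
    = place_val w s / place_val v s.
  have := congr1 (fun u : FR P => place_val u s) ew.
  rewrite !place_valM !place_val_const place_val_embed rmorphM fmorphV => e.
  have v_neq0 := FR_conn_neq0 s v_conn.
  have cJ_neq0 : (ideal_scale J)%:C%C != 0 :> R[i] by rewrite fmorph_eq0 gt_eqF.
  apply: (mulfI cJ_neq0); rewrite [RHS]mulrA -e.
  by field; rewrite v_neq0.
have f1 : f = 1.
  apply: (strongly_reduced_scaling C_ge1 (delta_sqr C_ge1) (delta_ge0 C_ge1)
    c_gt0 f_neq0 I_red J_red def_I) => s.
  have v_neq0 := FR_conn_neq0 s v_conn; have w_neq0 := FR_conn_neq0 s w_conn.
  by rewrite ratio invf_div; split; apply: cabs_div_sub1_lt.
have eq_IJ : I = J.
  rewrite def_I f1; apply/seteqP; split=> [_ [y Jy <-]|y Jy]; first by rewrite mul1r.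
  by exists y; rewrite ?mul1r.
congr pair => //; rewrite -ew f1; apply: place_val_inj => s.
by rewrite [RHS]place_valM place_val_embed rmorph1 mulr1.
Qed.

End Divisors.

Theorem theorem4p8 (R : realType) (F : fieldExtType rat)
    (P : infinite_places R F) (C : R) (hC : 1 <= C) :
  (forall D D' : odivisor P,
     oDiv0 D -> oDiv0 D' -> Sred P C D -> Sred P C D' ->
     ((exists (f : F) (v : FR P),
         [/\ totally_positive P f,
             FR_unit v,
             odiv_add (odiv_sub D D') (principal P f) = (OF F, v)
           & forall s : place P, cabs (Log (place_val v s)) < delta C]) ->
      D = D') /\
     ((exists (f : F) (v : FR P),
         [/\ totally_positive P f,
             FR_unit v,
             odiv_add (odiv_sub D D') (principal P f) = (OF F, v)
           & Pic_norm v < delta C]) ->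
      D = D')) /\
  (let U : set (odivisor P) :=
     \bigcup_(D in Sred P C)
       [set odiv_add D (OF F, v) | v in
          [set v : FR P | FR_conn0 v /\
             forall s : place P, cabs (Log (place_val v s)) < 2^-1 * delta C]] in
   set_fun U (oPic0 P) (odiv_class P) /\
   set_inj U (odiv_class P)).
Proof.
split.
  move=> D D' _ _ [I I_red <-] [J J_red <-]; split.
    move=> [f [v [[f_neq0 _] _ Df log_lt]]].
    rewrite (Sred_eq hC I_red J_red f_neq0 Df) //.
    by exists 1 => [|s]; [exact: positive_units1 | rewrite rmorph1 mulr1].
  move=> [f [v [[f_neq0 _] _ Df /Pic_norm_lt Pic_lt]]].
  by rewrite (Sred_eq hC I_red J_red f_neq0 Df).
split=> [_ [_ [I [I_frac _ _ _] <-] [v [v_conn _] <-]]|A B].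
  by eexists; first exact: odiv_of_ideal_deg0 I_frac v_conn.
rewrite !in_setE => -[_ [I I_red <-] [v [[v_conn _] v_lt] <-]].
move=> -[_ [J J_red <-] [w [[w_conn _] w_lt] <-]].
have [[I_frac _ _ _] [J_frac _ _ _]] := (I_red, J_red).
rewrite !odiv_add_trivial //.
exact: (odiv_class_inj hC I_red J_red v_conn w_conn v_lt w_lt).
Qed.
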